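(* Let $(\Omega,\mathcal L,\mu)$ be a measure space and let $X$ be a Banach space not containing any isomorphic copy of $c_0$. If $\widetilde{\Gamma}\colon\Omega\to\mathcal F(X)$ is a scalarly integrable fuzzy mapping which is determined by a weakly compactly generated (WCG) space $Y\subseteq X$, then $\widetilde{\Gamma}$ is Pettis integrable.
   Context: $(\Omega,\mathcal L,\mu)$ is a measure space, $\mathcal L$ being the family of all $\mu$-measurable sets; $X$ is a (real) Banach space with dual $X^*$. $cwk(X)$ is the family of nonempty convex weakly compact subsets of $X$. For $A\in cwk(X)$ and $x^*\in X^*$, $s(x^*,A)=\sup\{\langle x^*,y\rangle: y\in A\}$. Fuzzy numbers: for $u\colon X\to[0,1]$ and $r\in(0,1]$ put $[u]^r=\{x\in X: u(x)\ge r\}$. $u$ is a generalized fuzzy number if $[u]^r\in cwk(X)$ for every $r\in(0,1]$; $\mathcal F(X)$ is the set of all generalized fuzzy numbers. A fuzzy mapping is a map $\widetilde{\Gamma}\colon\Omega\to\mathcal F(X)$; set $\widetilde{\Gamma}_r(\omega):=[\widetilde{\Gamma}(\omega)]^r$, and $s(x^*,\widetilde{\Gamma}_r)$ denotes the function $\omega\mapsto s(x^*,\widetilde{\Gamma}_r(\omega))$. A multifunction $\Gamma\colon\Omega\to cwk(X)$ is scalarly integrable if $s(x^*,\Gamma)$ is $\mu$-integrable for each $x^*\in X^*$; it is Pettis integrable if moreover for each $A\in\mathcal L$ there is $W_\Gamma(A)\in cwk(X)$ with $s(x^*,W_\Gamma(A))=\int_A s(x^*,\Gamma)\,d\mu$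 for all $x^*\in X^*$. A fuzzy mapping $\widetilde{\Gamma}$ is scalarly integrable if $\widetilde{\Gamma}_r$ is scalarly integrable for all $r\in(0,1]$. It is Pettis integrable if every $\widetilde{\Gamma}_r$, $r\in(0,1]$, is a Pettis integrable multifunction and, for each $A\in\mathcal L$, there is $\widetilde{M_\Gamma}(A)\in\mathcal F(X)$ such that $s(x^*,[\widetilde{M_\Gamma}(A)]^r)=\int_A s(x^*,\widetilde{\Gamma}_r)\,d\mu$ for all $r\in(0,1]$ and $x^*\in X^*$. A (linear sub)space $Y\subseteq X$ determines $\widetilde{\Gamma}$ if for each $r\in(0,1]$ and each $x^*\in Y^\perp$ (the annihilator of $Y$ in $X^*$) $s(x^*,\widetilde{\Gamma}_r)=0$ $\mu$-a.e., the exceptional sets depending on $x^*$ and $r$. A subspace $Y\subseteq X$ is weakly compactly generated (WCG) if there is a weakly compact set $K\subset Y$ with $Y=\overline{\mathrm{span}}(K)$. *)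

(* Defs.v *)
From HB Require Import structures.
From mathcomp Require Import all_boot all_order all_algebra.
From mathcomp Require Import all_classical all_reals all_analysis.

Set Implicit Arguments.
Unset Strict Implicit.
Unset Printing Implicit Defensive.

Import Order.TTheory GRing.Theory Num.Theory.
Import numFieldNormedType.Exports.

Local Open Scope classical_set_scope.
Local Open Scope ring_scope.

Section c0_space.
Variable R : realType.

Definition null_seq : {pred R^nat} := mem [set a : R^nat | a @ \oo --> (0 : R)].

Lemma null_seq_submod_closed : submod_closed null_seq.
Proof.
split=> [|l a b]; rewrite !inE /=; first exact: cvg_cst.
move=> a0 b0.
have := cvgD (cvgM (cvg_cst l : (fun=> l) @ \oo --> l) a0) b0.
by rewrite mulr0 addr0 => h; exact: h.
Qed.

HB.instance Definition _ :=
  GRing.isSubmodClosed.Build R R^nat null_seq null_seq_submod_closed.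

Record c0 := C0 { c0_val :> nat -> R; _ : c0_val \in null_seq }.
HB.instance Definition _ := [isSub for c0_val].
HB.instance Definition _ := [Choice of c0 by <:].
HB.instance Definition _ := [SubChoice_isSubLmodule of c0 by <:].

Definition c0_norm (a : c0) : R := sup (range (fun n => `|a n|)).

Lemma c0_has_sup (a : c0) : has_sup (range (fun n => `|a n|)).
Proof.
split; first by exists `|a 0%N|, 0%N.
case: a => a /= /[!inE] /= a0.
have [M [_ aM]] := cvg_seq_bounded (cvgP _ a0).
exists (M + 1) => _ [n _ <-]; apply: aM => //; by rewrite ltrDl.
Qed.

Lemma c0_norm_ub (a : c0) n : `|a n| <= c0_norm a.
Proof. by apply: sup_upper_bound; [exact: c0_has_sup|exists n]. Qed.

Lemma c0_norm_le (a : c0) M : (forall n, `|a n| <= M) -> c0_norm a <= M.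
Proof.
move=> aM; apply: ge_sup; first by case: (c0_has_sup a).
by move=> _ [n _ <-].
Qed.

Lemma c0_normD (a b : c0) : c0_norm (a + b) <= c0_norm a + c0_norm b.
Proof.
apply: c0_norm_le => n; apply: le_trans (ler_normD (a n) (b n)) _.
by rewrite lerD// c0_norm_ub.
Qed.

Lemma c0_normZ (l : R) (a : c0) : c0_norm (l *: a) = `|l| * c0_norm a.
Proof.
have le k (b : c0) : c0_norm (k *: b) <= `|k| * c0_norm b.
  apply: c0_norm_le => n; rewrite [X in `|X|](_ : _ = k * b n)//.
  by rewrite normrM ler_wpM2l// c0_norm_ub.
apply/eqP; rewrite eq_le le /=.
have [->|l0] := eqVneq l 0.
  rewrite normr0 mul0r; apply: le_trans (c0_norm_ub _ 0%N); exact: normr_ge0.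
rewrite -ler_pdivlMl ?normr_gt0// -normfV.
by rewrite -[X in c0_norm X <= _](scalerK l0 a) le.
Qed.

Lemma c0_norm_eq0 (a : c0) : c0_norm a = 0 -> a = 0.
Proof.
move=> a0; apply/val_inj/funext => n; apply/eqP.
by rewrite -normr_le0 -a0 c0_norm_ub.
Qed.

HB.instance Definition _ :=
  Lmodule_isNormed.Build R c0 c0_normD c0_normZ c0_norm_eq0.

End c0_space.

(* some linear map from E to X is an isomorphism onto its range *)
Definition contains_copy (R : realType) (E X : normedModType R) : Prop :=
  exists f : {linear E -> X}, exists m M : R,
    [/\ 0 < m, 0 < M & forall a, m * `|a| <= `|f a| <= M * `|a|].

Section banach.
Variables (R : realType) (X : completeNormedModType R).

Record dual_space := DualSpace {
  dual_fun :> {linear X -> R^o} ;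
  dual_continuous : continuous dual_fun }.

(* X with sigma(X, X'), the coarsest topology for which every element of the
   dual X' is continuous *)
Definition weak_space : Type :=
  sup_topology (fun f : dual_space => Topological.class (initial_topology (f : X -> R^o))).
HB.instance Definition _ := Topological.on weak_space.

Definition weakly_compact (A : set X) : Prop := compact (A : set weak_space).

Definition cwk (A : set X) : Prop :=
  [/\ A !=set0, convex_set (A : set (convex_lmodType X)) & weakly_compact A].

(* On weakly compact nonempty A the set f @` A is nonempty and bounded, so the
   real-valued sup is the actual supremum. *)
Definition support_fun (f : dual_space) (A : set X) : R := sup (f @` A).

Definition annihilator (Y : set X) : set dual_space :=
  [set f : dual_space | forall y, Y y -> f y = 0].

Definition lin_span (K : set X) : set X :=
  [set x | exists n (a : 'I_n -> R) (k : 'I_n -> X),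
    (forall i, K (k i)) /\ x = \sum_(i < n) a i *: k i].

Definition WCG (Y : set X) : Prop :=
  submod_closed (mem Y) /\
  exists K : set X,
    [/\ weakly_compact K, K `<=` Y & Y = closure (lin_span K)].

Definition level_set (u : X -> R) (r : R) : set X := [set x | r <= u x].

Record fuzzy_number := FuzzyNumber {
  fuzzy_fun :> X -> R ;
  fuzzy_range : forall x, 0 <= fuzzy_fun x <= 1 ;
  fuzzy_level : forall r, 0 < r <= 1 -> cwk (level_set fuzzy_fun r) }.

End banach.

Section pettis.
Context d (T : measurableType d) (R : realType) (X : completeNormedModType R).
Variable mu : {measure set T -> \bar R}.

(* The multifunctions G to which the next two notions are applied are the level
   multifunctions of fuzzy mappings, hence have values in cwk by fuzzy_level. *)
Definition scalarly_integrable (G : T -> set X) : Prop :=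
  forall f : dual_space X, mu.-integrable setT (fun w => (support_fun f (G w))%:E).

Definition pettis_integrable (G : T -> set X) : Prop :=
  scalarly_integrable G /\
  forall A, measurable A -> exists W : set X, cwk W /\
    forall f : dual_space X,
      (support_fun f W)%:E = (\int[mu]_(w in A) (support_fun f (G w))%:E)%E.

Definition fuzzy_scalarly_integrable (G : T -> fuzzy_number X) : Prop :=
  forall r : R, 0 < r <= 1 -> scalarly_integrable (fun w => level_set (G w) r).

Definition fuzzy_pettis_integrable (G : T -> fuzzy_number X) : Prop :=
  (forall r : R, 0 < r <= 1 -> pettis_integrable (fun w => level_set (G w) r)) /\
  forall A, measurable A -> exists M : fuzzy_number X,
    forall (r : R) (f : dual_space X), 0 < r <= 1 ->
      (support_fun f (level_set M r))%:E =
      (\int[mu]_(w in A) (support_fun f (level_set (G w) r))%:E)%E.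

Definition determines (Y : set X) (G : T -> fuzzy_number X) : Prop :=
  forall (r : R) (f : dual_space X), 0 < r <= 1 -> annihilator Y f ->
    {ae mu, forall w, support_fun f (level_set (G w) r) = 0}.

End pettis.

(* Main.v *)
(** Fix a level and a measurable set [A], and let [phi f] be the integral over [A] of
    the support function of the level multifunction [G] in the direction [f]. By
    Hahn-Banach, a weakly compact convex set with support function [phi] exists as
    soon as every linear [l <= phi] on the dual is evaluation at a point of [X].

    Let [Y] be the closed span of the weakly compact set [K]. If [l] is not evaluation
    at a point of [Y], Whitley's construction yields [z n] in the dual ball with
    [z n --> 0] on [Y] and [e <= l (z n)]. Suppose first that the measure is finite
    and the support functions in the directions of the dual ball are uniformly
    essentially bounded. The argument of Simons' inequality produces one selection
    [s] of [G] (choosing lexicographically maximal points) and functionals in the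
    hulls of the tails of [z] whose integrals along [s] stay above [e / 2]. Hilbert
    space minimization turns these into an almost everywhere convergent sequence. Its
    limit along [s] comes from a functional vanishing on [Y], so it is [0] because
    [Y] determines [G]: contradiction. In general, [A] is exhausted, up to a set where
    all [z n] vanish along [G], by countably many sets of the previous kind, along
    which [l] splits into points [x j] of [Y]. The series of the [x j] is weakly
    unconditionally Cauchy, so it converges by the Bessaga-Pelczynski theorem, and
    its sum [x] satisfies [l (z n) = z n x --> 0]: contradiction.

    Finally the sets obtained for the levels [r] are the levels of one fuzzy number,
    since by dominated convergence [phi] is left continuous in [r]. *)

From HB Require Import structures.
Require Import Defs.
From mathcomp Require Import all_boot all_order all_algebra.
From mathcomp Require Import all_classical all_reals all_analysis.
From mathcomp Require Import measurable_realfun ring lra.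

Set Implicit Arguments.
Unset Strict Implicit.
Unset Printing Implicit Defensive.

Import Order.TTheory GRing.Theory Num.Theory.
Import numFieldNormedType.Exports.

Local Open Scope classical_set_scope.
Local Open Scope ring_scope.


(** * Hahn-Banach theorems *)

Section hahn_banach.
Variables (R : realType) (V : lmodType R).
Implicit Types p q l : V -> R.

Definition sublinear p :=
  (forall x y, p (x + y) <= p x + p y) /\
  (forall (t : R) x, 0 <= t -> p (t *: x) = t * p x).

Lemma sublinear0 p : sublinear p -> p 0 = 0.
Proof. by case=> _ /(_ 0 0 (lexx _)); rewrite scale0r mul0r. Qed.

Lemma sublinear_geN p x : sublinear p -> - p (- x) <= p x.
Proof.
move=> sp; rewrite -subr_ge0 opprK -(sublinear0 sp) -(subrr x).
by case: sp.
Qed.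

Lemma sublinearP p : (forall x y, p (x + y) <= p x + p y) -> p 0 = 0 ->
  (forall t x, 0 < t -> p (t *: x) <= t * p x) -> sublinear p.
Proof.
move=> pD p0 pZ; split=> // t x; rewrite le_eqVlt => /predU1P[<-|t0].
  by rewrite scale0r mul0r.
apply/eqP; rewrite eq_le pZ//= -ler_pdivlMl//.
have := pZ t^-1 (t *: x); rewrite invr_gt0 => /(_ t0).
by rewrite scalerA mulVf ?gt_eqF// scale1r.
Qed.

Lemma scalar0 l : scalar l -> l 0 = 0.
Proof.
move=> ll; have := ll 1 0 0.
by rewrite scaler0 addr0 /= mul1r => /eqP; rewrite -subr_eq subrr eq_sym => /eqP.
Qed.

Lemma scalarD l x y : scalar l -> l (x + y) = l x + l y.
Proof. by move=> ll; have := ll 1 x y; rewrite scale1r /= mul1r. Qed.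

Lemma scalarMl l t x : scalar l -> l (t *: x) = t * l x.
Proof. by move=> ll; have := ll t x 0; rewrite (scalar0 ll) !addr0. Qed.

Lemma scalarN l x : scalar l -> l (- x) = - l x.
Proof. by move=> ll; rewrite -scaleN1r scalarMl// mulN1r. Qed.

Lemma scalarB l x y : scalar l -> l (x - y) = l x - l y.
Proof. by move=> ll; rewrite scalarD// scalarN. Qed.

Lemma scalar_le_norm p l x : scalar l -> (forall y, l y <= p y) ->
  `|l x| <= Num.max (p x) (p (- x)).
Proof.
move=> ll lp; rewrite ler_norml lerNl -(scalarN x ll) !le_max !lp.
by rewrite orbT.
Qed.

Lemma scalar_sub k l : scalar k -> scalar l -> scalar (fun x => k x - l x).
Proof. by move=> sk sl t x y; rewrite sk sl /= mulrBr; ring. Qed.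

(** [q' y] is the infimum of [q (y + t *: x) - t * q x] over [t >= 0]: [t = 0] gives [q' <= q], and
    [t = 1] at [- x] gives the last bound. It drives both the minimality argument and the attainment
    in [hahn_banach_at]. *)
Lemma sublinear_directional q x : sublinear q ->
  exists q', [/\ sublinear q', forall y, q' y <= q y & q' (- x) <= - q x].
Proof.
move=> sq; have [qD qZ] := sq.
pose v (y : V) : set R := [set q (y + t *: x) - t * q x | t in [set t : R | 0 <= t]].
have v0 y : v y !=set0 by exists (q (y + 0 *: x) - 0 * q x), 0 => /=.
have lbv y : lbound (v y) (- q (- y)).
  move=> _ [t t0 <-]; rewrite lerBrDr -qZ//.
  have := qD (- y) (y + t *: x); rewrite addrA addNr add0r => h.
  by rewrite addrC lerBlDl.
have hasi y : has_inf (v y) by split; [exact: v0|exists (- q (- y))].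
have infle t y : 0 <= t -> inf (v y) <= q (y + t *: x) - t * q x.
  by move=> t0; apply: ge_inf; [case: (hasi y)|exists t].
have ileq y : inf (v y) <= q y.
  by have := infle 0 y (lexx _); rewrite scale0r addr0 mul0r subr0.
exists (fun y => inf (v y)); split=> //; last first.
  have := infle 1 (- x) ler01.
  by rewrite scale1r mul1r addNr sublinear0// sub0r.
apply: sublinearP.
- move=> y z; rewrite -lerBlDr; apply: lb_le_inf => // _ [s /= s0 <-].
  rewrite lerBlDr -lerBlDl; apply: lb_le_inf => // _ [t /= t0 <-].
  rewrite lerBlDl; apply: le_trans (infle (s + t) _ (addr_ge0 s0 t0)) _.
  have := qD (y + s *: x) (z + t *: x); rewrite addrACA -scalerDl; lra.
- apply/eqP; rewrite eq_le -{1}(sublinear0 sq) ileq/=.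
  by apply: lb_le_inf => // _ [t /= t0 <-]; rewrite add0r qZ// subrr.
- move=> t y t0; rewrite -ler_pdivrMl//; apply: lb_le_inf => // _ [s /= s0 <-].
  rewrite ler_pdivrMl//.
  apply: le_trans (infle (t * s) _ (mulr_ge0 (ltW t0) s0)) _.
  rewrite -scalerA -scalerDr (qZ _ _ (ltW t0)).
  by rewrite mulrBr mulrA.
Qed.

Section minimal.
Variable p : V -> R.
Hypothesis sp : sublinear p.

Let below := {q : V -> R | sublinear q /\ forall x, q x <= p x}.

(** The bound is the pointwise infimum, finite because every member is at least [- p (- x)]. For
    subadditivity, the smaller of two members of the chain serves both arguments. *)
Let chain_inf (A : set below) (A0 : A !=set0) :
  (forall s t, A s -> A t ->
    (forall x, sval t x <= sval s x) \/ (forall x, sval s x <= sval t x)) ->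
  exists q : below, forall s, A s -> forall x, sval q x <= sval s x.
Proof.
move=> Atot; pose v x := [set sval s x | s in A].
have v0 x : v x !=set0 by case: A0 => s As; exists (sval s x), s.
have vlb x : lbound (v x) (- p (- x)).
  move=> _ [s As <-]; have [ss sps] := svalP s.
  by apply: le_trans (sublinear_geN _ ss); rewrite lerN2.
have hasi x : has_inf (v x) by split; [exact: v0|exists (- p (- x))].
have infle s x : A s -> inf (v x) <= sval s x.
  by move=> As; apply: ge_inf; [case: (hasi x)|exists s].
have qle x : inf (v x) <= p x.
  case: A0 => s As; apply: le_trans (infle s x As) _.
  by have [_] := svalP s.
suff sq : sublinear (fun x => inf (v x)).
  have bq : sublinear (fun x => inf (v x)) /\ forall x, inf (v x) <= p x by [].
  by exists (exist _ _ bq : below) => s As x /=; exact: infle.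
apply: sublinearP.
- move=> x y; rewrite -lerBlDr; apply: lb_le_inf => // _ [s As <-].
  rewrite lerBlDr -lerBlDl; apply: lb_le_inf => // _ [t At <-].
  rewrite lerBlDl.
  have [ts|st] := Atot _ _ As At.
  + apply: le_trans (infle t _ At) _; have [[tD _] _] := svalP t.
    have := tD x y; have := ts x; have := ts y; lra.
  + apply: le_trans (infle s _ As) _; have [[sD _] _] := svalP s.
    have := sD x y; have := st x; have := st y; lra.
- rewrite (_ : v 0 = [set 0]) ?inf1//; apply/seteqP; split=> [_ [s As <-]|_ ->].
    by have [ss _] := svalP s; rewrite /= sublinear0.
  case: A0 => s As; exists s => //.
  by have [ss _] := svalP s; rewrite sublinear0.
- move=> t x t0; rewrite -ler_pdivrMl//; apply: lb_le_inf => // _ [s As <-].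
  rewrite ler_pdivrMl//; apply: le_trans (infle s _ As) _.
  by have [[_ sZ] _] := svalP s; rewrite sZ// ltW.
Qed.

(* A minimal sublinear [q <= p] is linear: minimality against the functional of
   [sublinear_directional] gives [q (- x) <= - q x]. *)
Theorem hahn_banach : exists l, scalar l /\ forall x, l x <= p x.
Proof.
(* The order is reversed, so that a maximal element for Zorn's lemma is a pointwise minimal
   functional. *)
pose Rel (s t : {classic below}) : bool := `[< forall x, sval t x <= sval s x >].
have bp : below by exists p.
have [|||[q [sq qp]] qmin] := @ZL_preorder {classic below} bp Rel.
- by move=> t; apply/asboolP.
- move=> r s t /asboolP rs /asboolP st; apply/asboolP => x.
  exact: le_trans (st x) (rs x).
- move=> A Atot; have [A0|A0] := pselect (A !=set0); last first.
    by exists bp => s As; exfalso; apply: A0; exists s.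
  have [|m Am] := chain_inf A0.
    by move=> s t As At; have [/asboolP|/asboolP] := Atot s t As At; [left|right].
  by exists m => s As; apply/asboolP; exact: Am.
have qN x : q (- x) <= - q x.
  have [i [si iq ix]] := sublinear_directional x sq.
  have ip y : i y <= p y by exact: le_trans (iq y) (qp y).
  have bi : sublinear i /\ forall y, i y <= p y by [].
  have /asboolP/(_ (- x)) /= := qmin (exist _ _ bi : below) (asboolT iq).
  by move=> /le_trans; apply.
exists q; split=> // t x y; have [qD qZ] := sq.
have qNE z : q (- z) = - q z.
  by apply/eqP; rewrite eq_le qN/= lerNl; exact: sublinear_geN.
have DE u w : q (u + w) = q u + q w.
  apply/eqP; rewrite eq_le qD/=.
  have := qD (- u) (- w); rewrite -opprD !qNE; lra.
rewrite DE; congr (_ + _); have [/qZ//|t0] := leP 0 t.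
rewrite -[t]opprK scaleNr qNE qZ; first by rewrite !mulNr.
by rewrite oppr_ge0 ltW.
Qed.

End minimal.

Lemma hahn_banach_at p x : sublinear p ->
  exists l, [/\ scalar l, forall y, l y <= p y & l x = p x].
Proof.
move=> sp; have [q [sq qp qx]] := sublinear_directional x sp.
have [l [ll lq]] := hahn_banach sq.
have lp y : l y <= p y by exact: le_trans (lq y) (qp y).
exists l; split=> //; apply/eqP; rewrite eq_le lp/= -lerN2 -(scalarN x ll).
exact: le_trans (lq _) qx.
Qed.

(** [k] lies below the infimum over [y] of [p (x + y) - l y + q y]. Taking [y = 0] gives [k <= p];
    evaluating at [- x] with [y = x] gives [l - k <= q]. It serves to distribute a functional over
    two disjoint sets of integration. *)
Lemma sublinear_sandwich p q l : sublinear p -> sublinear q -> scalar l ->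
  (forall x, l x <= p x + q x) ->
  exists k, [/\ scalar k, forall x, k x <= p x & forall x, l x - k x <= q x].
Proof.
move=> sp sq ll lpq; have [[pD pZ] [qD qZ]] := (sp, sq).
pose v (x : V) : set R := range (fun y => p (x + y) - l y + q y).
have v0 x : v x !=set0 by exists (p (x + 0) - l 0 + q 0), 0.
have hasi x : has_inf (v x).
  split=> //; exists (- p (- x)) => _ [y _ <-].
  have := lpq y; have := pD (- x) (x + y); rewrite addrA addNr add0r; lra.
have infle x y : inf (v x) <= p (x + y) - l y + q y.
  by apply: ge_inf; [case: (hasi x)|exists y].
have si : sublinear (fun x => inf (v x)).
  apply: sublinearP.
  - move=> x y; rewrite -lerBlDr; apply: lb_le_inf => // _ [a _ <-].
    rewrite lerBlDr -lerBlDl; apply: lb_le_inf => // _ [b _ <-].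
    rewrite lerBlDl; have := infle (x + y) (a + b).
    have := pD (x + a) (y + b); rewrite addrACA (scalarD _ _ ll).
    have := qD a b; lra.
  - apply/eqP; rewrite eq_le; apply/andP; split.
      have := infle 0 0.
      by rewrite addr0 (sublinear0 sp) (sublinear0 sq) (scalar0 ll) subr0 addr0.
    by apply: lb_le_inf => // _ [y _ <-]; have := lpq y; rewrite add0r; lra.
  - move=> t x t0; rewrite -ler_pdivrMl//; apply: lb_le_inf => // _ [y _ <-].
    rewrite ler_pdivrMl//; have := infle (t *: x) (t *: y).
    rewrite -scalerDr (pZ _ _ (ltW t0)) (qZ _ _ (ltW t0)) (scalarMl _ _ ll).
    lra.
have [k [lk ki]] := hahn_banach si.
exists k; split=> // x; first apply: le_trans (ki _) _.
  have := infle x 0.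
  by rewrite addr0 (sublinear0 sq) (scalar0 ll) subr0 addr0.
have := le_trans (ki (- x)) (infle (- x) x).
rewrite addNr (sublinear0 sp) (scalarN _ lk); lra.
Qed.

(** [k] lies below the infimum of [p (x + y) - l y] over [y] in [N]. Evaluating at [- x] with
    [y = x] gives [l <= k] on [N], and stability of [N] under negation turns this into equality. *)
Lemma hahn_banach_extension p l (N : V -> Prop) : sublinear p -> scalar l ->
  N 0 -> (forall x y, N x -> N y -> N (x + y)) ->
  (forall (t : R) x, N x -> N (t *: x)) -> (forall x, N x -> l x <= p x) ->
  exists k, [/\ scalar k, forall x, k x <= p x & forall x, N x -> k x = l x].
Proof.
move=> sp ll N0 ND NZ lp; have [pD pZ] := sp.
pose v (x : V) : set R := [set p (x + y) - l y | y in N].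
have v0 x : v x !=set0 by exists (p (x + 0) - l 0), 0.
have hasi x : has_inf (v x).
  split=> //; exists (- p (- x)) => _ [y Ny <-].
  have := lp _ Ny; have := pD (- x) (x + y); rewrite addrA addNr add0r; lra.
have infle x y : N y -> inf (v x) <= p (x + y) - l y.
  by move=> Ny; apply: ge_inf; [case: (hasi x)|exists y].
have si : sublinear (fun x => inf (v x)).
  apply: sublinearP.
  - move=> x y; rewrite -lerBlDr; apply: lb_le_inf => // _ [a Na <-].
    rewrite lerBlDr -lerBlDl; apply: lb_le_inf => // _ [b Nb <-].
    rewrite lerBlDl; have := infle (x + y) (a + b) (ND _ _ Na Nb).
    have := pD (x + a) (y + b); rewrite addrACA (scalarD _ _ ll).
    lra.
  - apply/eqP; rewrite eq_le; apply/andP; split.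
      by have := infle 0 0 N0; rewrite addr0 (sublinear0 sp) (scalar0 ll) subr0.
    by apply: lb_le_inf => // _ [y Ny <-]; have := lp _ Ny; rewrite add0r; lra.
  - move=> t x t0; rewrite -ler_pdivrMl//; apply: lb_le_inf => // _ [y Ny <-].
    rewrite ler_pdivrMl//; have := infle (t *: x) (t *: y) (NZ _ _ Ny).
    rewrite -scalerDr (pZ _ _ (ltW t0)) (scalarMl _ _ ll).
    lra.
have [k [lk ki]] := hahn_banach si.
have kl x : N x -> l x <= k x.
  move=> Nx; have := le_trans (ki (- x)) (infle (- x) x Nx).
  rewrite addNr (sublinear0 sp) (scalarN _ lk); lra.
exists k; split=> // x => [|Nx].
  apply: le_trans (ki x) _.
  by have := infle x 0 N0; rewrite addr0 (scalar0 ll) subr0.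
apply/eqP; rewrite eq_le kl// andbT -lerN2 -(scalarN _ lk) -(scalarN _ ll).
by apply: kl; rewrite -scaleN1r; exact: NZ.
Qed.

End hahn_banach.


(** * The dual space *)

(* A copy of [dual_space] whose elements are applied with codomain [R] instead of
   [R^o]: this keeps the arithmetic of their values in a single structure. *)
Record dual (R : realType) (X : completeNormedModType R) :=
  Dual { dual_val : dual_space X }.
Definition dual_app (R : realType) (X : completeNormedModType R)
  (f : dual X) : X -> R := dual_fun (dual_val f).
Coercion dual_app : dual >-> Funclass.
Coercion dual_val : dual >-> dual_space.

Section dual.
Variables (R : realType) (X : completeNormedModType R).
Local Notation V := (dual X).
Implicit Types (f g : V) (x y : X).

Lemma dual_ext f g : (forall x, f x = g x) -> f = g.
Proof.
move=> /funext; case: f g => [[f cf]] [[g cg]]; rewrite /dual_app/= => fg.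
have {}fg : (f : X -> R) = g by exact: fg.
have {}fg : f = g.
  case: f g fg cf cg => [f [[mf1] [mf2]]] [g [[mg1] [mg2]]] /= fg _ _; subst g.
  by rewrite (Prop_irrelevance mf1 mg1) (Prop_irrelevance mf2 mg2).
by subst g; congr (Dual (DualSpace _)); exact: Prop_irrelevance.
Qed.

Lemma dual_bounded f : exists2 M, 0 < M & forall x, `|f x| <= M * `|x|.
Proof.
have /linear_bounded_continuous/linear_boundedP := dual_continuous (d := dual_val f).
case=> M0 [M0r fM]; exists (Num.max M0 0 + 1) => [|x].
  by rewrite ltr_wpDl// le_max lexx orbT.
by apply: fM; rewrite ltr_pwDr// le_max lexx.
Qed.

Lemma dual_of_bounded (h : X -> R) r : scalar h ->
  (forall x, `|h x| <= r * `|x|) -> exists f, forall x, f x = h x.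
Proof.
move=> sh hr.
pose hm := GRing.isLinear.Build R X R^o *%R h sh.
pose hl : {linear X -> R^o} := HB.pack h hm.
have hc : continuous hl.
  apply/linear_bounded_continuous/linear_boundedP; exists r.
  split; first exact: num_real.
  by move=> s rs x; apply: le_trans (hr x) _; rewrite ler_wpM2r// ltW.
by exists (Dual (DualSpace hc)).
Qed.

Definition dual_add f g : V := Dual (@DualSpace R X (dual_fun f \+ dual_fun g)
  (fun x => continuousD (@dual_continuous _ _ f x) (@dual_continuous _ _ g x))).
Definition dual_opp f : V := Dual (@DualSpace R X (\- dual_fun f)
  (fun x => continuousN (@dual_continuous _ _ f x))).
Definition dual_scale a f : V := Dual (@DualSpace R X (a \*: dual_fun f)
  (fun x => @continuousZl_tmp _ _ _ _ a x (@dual_continuous _ _ f x))).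
Definition dual_zero : V :=
  Dual (@DualSpace R X \0 (fun x => @cst_continuous _ _ _ x)).

Let dual_addA : associative dual_add.
Proof. by move=> f g h; apply: dual_ext => x; exact: addrA. Qed.
Let dual_addC : commutative dual_add.
Proof. by move=> f g; apply: dual_ext => x; exact: addrC. Qed.
Let dual_add0 : left_id dual_zero dual_add.
Proof. by move=> f; apply: dual_ext => x; exact: add0r. Qed.
Let dual_addN : left_inverse dual_zero dual_opp dual_add.
Proof. by move=> f; apply: dual_ext => x; exact: addNr. Qed.

HB.instance Definition _ := gen_eqMixin V.
HB.instance Definition _ := gen_choiceMixin V.
HB.instance Definition _ :=
  GRing.isZmodule.Build V dual_addA dual_addC dual_add0 dual_addN.

Let dual_scaleA a b f : dual_scale a (dual_scale b f) = dual_scale (a * b) f.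
Proof. by apply: dual_ext => x; exact: scalerA. Qed.
Let dual_scale1 : left_id 1 dual_scale.
Proof. by move=> f; apply: dual_ext => x; exact: scale1r. Qed.
Let dual_scaleDr : right_distributive dual_scale +%R.
Proof. by move=> a f g; apply: dual_ext => x; exact: scalerDr. Qed.
Let dual_scaleDl f : {morph dual_scale^~ f : a b / a + b}.
Proof. by move=> a b; apply: dual_ext => x; exact: scalerDl. Qed.

HB.instance Definition _ := GRing.Zmodule_isLmodule.Build R V
  dual_scaleA dual_scale1 dual_scaleDr dual_scaleDl.

Lemma dualDE f g x : (f + g) x = f x + g x. Proof. by []. Qed.
Lemma dualNE f x : (- f) x = - f x. Proof. by []. Qed.
Lemma dualZE a f x : (a *: f) x = a * f x. Proof. by []. Qed.
Lemma dual0E x : (0 : V) x = 0. Proof. by []. Qed.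
Definition dualE := (dualDE, dualNE, dualZE, dual0E).

Lemma dual_sumE I (r : seq I) (P : pred I) (F : I -> V) x :
  (\sum_(i <- r | P i) F i) x = \sum_(i <- r | P i) F i x.
Proof. by elim/big_rec2: _ => // i y g _ <-. Qed.

Lemma dual_addr f x y : f (x + y) = f x + f y.
Proof. exact: (linearD (dual_fun f)). Qed.

Lemma dual_subr f x y : f (x - y) = f x - f y.
Proof. exact: (linearB (dual_fun f)). Qed.

Lemma dual_scaler f a x : f (a *: x) = a * f x.
Proof. exact: (linearZ_LR (dual_fun f)). Qed.

Lemma dual_sumr f I (r : seq I) (P : pred I) (F : I -> X) :
  f (\sum_(i <- r | P i) F i) = \sum_(i <- r | P i) f (F i).
Proof. exact: (linear_sum (dual_fun f)). Qed.

Lemma dual_oppr f x : f (- x) = - f x.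
Proof. exact: (linearN (dual_fun f)). Qed.

Lemma dual_app0 f : f 0 = 0.
Proof. exact: (linear0 (dual_fun f)). Qed.

Lemma dual_app_continuous f : continuous (f : X -> R).
Proof. exact: (@dual_continuous _ _ f). Qed.

Definition in_ball f := forall x, `|f x| <= `|x|.

Lemma norming x : exists2 f, in_ball f & f x = `|x|.
Proof.
have sn : sublinear (fun x : X => `|x|).
  split=> [y z|t y t0]; first exact: ler_normD.
  by rewrite normrZ ger0_norm.
have [l [ll ln lx]] := hahn_banach_at x sn.
have [|f fl] := dual_of_bounded (r := 1) ll.
  by move=> y; rewrite mul1r -[leRHS]maxxx -{2}(normrN y); exact: scalar_le_norm.
exists f => [y|]; rewrite fl// -[leRHS]maxxx -{2}(normrN y).
exact: scalar_le_norm.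
Qed.

Lemma norm_le_dual x M : (forall f, in_ball f -> f x <= M) -> `|x| <= M.
Proof. by move=> xM; have [f fB <-] := norming x; exact: xM. Qed.

(** This is the operator norm: the unit ball is symmetric, so no absolute value is taken. *)
Definition dnorm f : R := sup [set f x | x in [set x | `|x| <= 1]].

Let dnorm_has_sup f : has_sup [set f x | x in [set x | `|x| <= 1]].
Proof.
split; first by exists (f 0), 0 => //=; rewrite normr0.
have [M M0 fM] := dual_bounded f; exists M => _ [x /= x1 <-].
by rewrite (le_trans (ler_norm _))// (le_trans (fM x))// ler_piMr// ltW.
Qed.

Lemma dnorm_bound f x : `|f x| <= dnorm f * `|x|.
Proof.
have [->|x0] := eqVneq x 0; first by rewrite dual_app0 !normr0 mulr0.
have h y : y != 0 -> f y <= dnorm f * `|y|.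
  move=> y0; have y0' : 0 < `|y| by rewrite normr_gt0.
  rewrite -ler_pdivrMr// mulrC -dual_scaler.
  apply: sup_upper_bound; first exact: dnorm_has_sup.
  exists (`|y|^-1 *: y) => //=.
  by rewrite normrZ normfV normr_id mulVf// gt_eqF.
rewrite ler_norml h// lerNl -dual_oppr -[`|x|]normrN h//.
by rewrite oppr_eq0.
Qed.

Lemma dnorm_ge0 f : 0 <= dnorm f.
Proof.
apply: sup_upper_bound; first exact: dnorm_has_sup.
by exists 0; rewrite /= ?normr0 ?dual_app0.
Qed.

Lemma dnorm_le f r : 0 <= r -> (forall x, f x <= r * `|x|) -> dnorm f <= r.
Proof.
move=> r0 fr; apply: ge_sup; first by case: (dnorm_has_sup f).
by move=> _ [x /= x1 <-]; apply: le_trans (fr x) _; rewrite ler_piMr.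
Qed.

Lemma dnorm_ball f : in_ball f <-> dnorm f <= 1.
Proof.
split=> [fB|f1 x]; last first.
  by apply: le_trans (dnorm_bound f x) _; rewrite ler_piMl.
by apply: dnorm_le => // x; rewrite mul1r (le_trans _ (fB x))// ler_norm.
Qed.

Lemma dnorm_sublinear : sublinear dnorm.
Proof.
apply: sublinearP => [f g||t f t0].
- apply: dnorm_le; first by rewrite addr_ge0// dnorm_ge0.
  move=> x. rewrite dualE mulrDl lerD// (le_trans (ler_norm _))//.
    exact: dnorm_bound.
  exact: dnorm_bound.
- by apply/eqP; rewrite eq_le dnorm_ge0 dnorm_le// => x; rewrite mul0r.
- apply: dnorm_le; first by rewrite mulr_ge0 ?dnorm_ge0// ltW.
  move=> x; rewrite dualE -mulrA ler_pM2l// (le_trans (ler_norm _))//.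
  exact: dnorm_bound.
Qed.

End dual.

(** Induction on [n]. If some [v0] is killed by all forms but the last, subtracting a multiple of
    the last form from [l] reduces to the first [n] forms; otherwise the common kernel of the first
    [n] forms already lies in that of the last. *)
Lemma scalar_kernel_sum (R : realType) (V : lmodType R) n
    (e : 'I_n -> V -> R) (l : V -> R) :
  (forall i, scalar (e i)) -> scalar l ->
  (forall v, (forall i, e i v = 0) -> l v = 0) ->
  exists a : 'I_n -> R, forall v, l v = \sum_(i < n) a i * e i v.
Proof.
elim: n e l => [|n IHn] e l se sl el.
  by exists (fun=> 0) => v; rewrite big_ord0; apply: el => -[].
have [e0|] := pselect (exists v, e ord_max v != 0 /\
    forall i, e (widen_ord (leqnSn n) i) v = 0); last first.
  move=> ne0; have [//|//||a la] := IHn (fun i => e (widen_ord (leqnSn n) i)) l.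
    move=> v ev; apply: el => i; have [->|ni] := eqVneq i ord_max.
      by apply/eqP; apply/negP => /negP emax; apply: ne0; exists v.
    have ltin : (i < n)%N by rewrite ltn_neqAle -ltnS ltn_ord andbT.
    by rewrite (_ : i = widen_ord (leqnSn n) (Ordinal ltin)) ?ev//; exact/val_inj.
  (* [insub] fails at the last index only, so the default [0] is the coefficient of the last
     form. *)
  exists (fun i => if insub (val i) is Some j then a j else 0) => v.
  rewrite big_ord_recr/= insubF ?ltnn// mul0r addr0 la.
  by apply: eq_bigr => i _; rewrite insubT//= => ?; congr (a _ * _); exact/val_inj.
have [v0 [emax ev0]] := e0.
pose c := l v0 / e ord_max v0.
have sk : scalar (fun v => l v - c * e ord_max v).
  by move=> t x y; rewrite sl se /=; ring.
have [//||a la] := IHn (fun i => e (widen_ord (leqnSn n) i)) _ _ sk.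
  move=> v ev; pose t := e ord_max v / e ord_max v0.
  have : l (v - t *: v0) = 0.
    apply: el => i; rewrite (scalarB _ _ (se i)) (scalarMl _ _ (se i)).
    have [->|ni] := eqVneq i ord_max; first by rewrite /t divfK// subrr.
    have ltin : (i < n)%N by rewrite ltn_neqAle -ltnS ltn_ord andbT.
    rewrite (_ : i = widen_ord (leqnSn n) (Ordinal ltin)); last exact/val_inj.
    by rewrite ev ev0 mulr0 subrr.
  rewrite (scalarB _ _ sl) (scalarMl _ _ sl) => /eqP; rewrite subr_eq0 => /eqP ->.
  by rewrite /t /c; field.
exists (fun i => if insub (val i) is Some j then a j else c) => v.
rewrite big_ord_recr/= insubF ?ltnn//.
rewrite -[LHS](subrK (c * e ord_max v)) la; congr (_ + _).
by apply: eq_bigr => i _; rewrite insubT//= => ?; congr (a _ * _); exact/val_inj.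
Qed.


(** * Ultralimits and weak compactness *)

Section ultrafilters.
Variables (R : realType) (I : Type).

(** An ultrafilter contains each set or its complement, so it suffices that it never contains the
    indices where [h] stays [e] away from [l]. This is what a cluster point provides. *)
Lemma ultra_near_cvg (U : set_system I) (UU : UltraFilter U) (h : I -> R) (l : R) :
  (forall e, 0 < e -> ~ (\forall i \near U, e <= `|h i - l|)) -> h @ U --> l.
Proof.
move=> hl; apply/cvgrPdist_lt => e e0.
have [//|h2] := in_ultra_setVsetC [set i | `|l - h i| < e] UU.
exfalso; apply: (hl _ e0); apply: filterS h2 => i /=.
by rewrite distrC => /negP; rewrite -leNgt.
Qed.

Lemma ultra_bounded_cvg (U : set_system I) (UU : UltraFilter U) (h : I -> R) M :
  (\forall i \near U, `|h i| <= M) -> exists l : R, h @ U --> l.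
Proof.
move=> hM; have [l [_ cl]] : [set` `[- M, M]] `&` cluster (h @ U) !=set0.
  apply: segment_compact; near=> i; rewrite /= in_itv/= -ler_norml.
  by near: i.
exists l; apply: ultra_near_cvg => e e0 ne.
have bl : nbhs l (ball l e) by exact: nbhsx_ballx.
have /= [y [/= ey]] := cl [set x | e <= `|x - l|] _ ne bl.
by rewrite /ball/= ltNge distrC ey.
Unshelve. all: by end_near. Qed.

Lemma cvg_le_near (F : set_system I) (FF : ProperFilter F) (h : I -> R) (l c : R) :
  h @ F --> l -> (\forall i \near F, h i <= c) -> l <= c.
Proof. by move=> hl hc; apply: (@cvgr_to_le _ _ _ _ h _ _ hl). Qed.

Lemma cvg_ge_near (F : set_system I) (FF : ProperFilter F) (h : I -> R) (l c : R) :
  h @ F --> l -> (\forall i \near F, c <= h i) -> c <= l.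
Proof. by move=> hl hc; apply: (@cvgr_to_ge _ _ _ _ h _ _ hl). Qed.

Lemma cvg_norm_le_near (F : set_system I) (FF : ProperFilter F) (h : I -> R) (l c : R) :
  h @ F --> l -> (\forall i \near F, `|h i| <= c) -> `|l| <= c.
Proof. by move=> hl; apply: cvg_le_near; exact: cvg_norm. Qed.

End ultrafilters.

(** Limits along such an ultrafilter replace the extraction of convergent subsequences. *)
Lemma free_ultrafilter : exists U : set_system nat, UltraFilter U /\ \oo `<=` U.
Proof. exact: ultraFilterLemma. Qed.

Section weak_topology.
Variables (R : realType) (X : completeNormedModType R).
Local Notation V := (dual X).
Implicit Types (f g : V) (x y : X) (K : set X).

(** A sequential form of the Banach-Alaoglu theorem: the pointwise limits exist by boundedness and
    inherit linearity and the bound. *)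
Lemma dual_ulim (U : set_system nat) (UU : UltraFilter U) (z : nat -> V) (r : R) :
  (forall n x, `|z n x| <= r * `|x|) ->
  exists y : V, (forall x, z n x @[n --> U] --> y x) /\
    forall x, `|y x| <= r * `|x|.
Proof.
move=> zr.
have /choice[h hz] : forall x, exists l : R, z n x @[n --> U] --> l.
  move=> x; apply: (@ultra_bounded_cvg _ _ _ _ (fun n => z n x) (r * `|x|)).
  by apply: nearW => n; exact: zr.
have hr x : `|h x| <= r * `|x|.
  by apply: cvg_norm_le_near (hz x) _; apply: nearW => n; exact: zr.
have sh : scalar h.
  move=> t x y.
  have key : z n (t *: x + y) @[n --> U] --> t * h x + h y.
    under eq_cvg do rewrite dual_addr dual_scaler.
    by apply: cvgD => //; apply: cvgM => //; exact: cvg_cst.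
  exact: cvg_unique (hz _) key.
have [y yh] := dual_of_bounded sh hr.
by exists y; split=> x; rewrite yh.
Qed.

Lemma dual_eq_point x y : (forall f, f x = f y) -> x = y.
Proof.
move=> xy; apply/eqP; rewrite -subr_eq0 -normr_le0; apply: norm_le_dual => f _.
by rewrite dual_subr xy subrr.
Qed.

Lemma weak_cvgP (F : set_system X) x (FF : Filter F) :
  F --> (x : weak_space X) <-> forall f, f y @[y --> F] --> f x.
Proof.
split=> [Fx f|Fx].
  have := (@cvg_sup X _ _ F x FF).1 Fx (dual_val f) => {}Fx.
  apply: cvg_trans (@initial_continuous X R^o (dual_val f) x).
  exact: cvg_app.
apply/cvg_sup => f A /=.
rewrite (@nbhsE (initial_topology (f : X -> R^o))) => -[_ [[B oB <-] Bx] BA].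
by apply: filterS BA _; apply: (Fx (Dual f)); exact: open_nbhs_nbhs.
Qed.

Lemma weakly_compact_ultraP K : weakly_compact K <->
  forall F : set_system X, UltraFilter F -> F K ->
    exists2 k, K k & forall f, f y @[y --> F] --> f k.
Proof.
rewrite /weakly_compact compact_ultra; split=> [cK F FU FK|cK F FU FK].
  by have [k [Kk /weak_cvgP Fk]] := cK F FU FK; exists k.
by have [k Kk Fk] := cK F FU FK; exists k; split=> //; apply/weak_cvgP.
Qed.

Lemma weakly_compact_cvg K (I : Type) (U : set_system I) (UU : UltraFilter U)
    (a : I -> X) : weakly_compact K -> (\forall i \near U, K (a i)) ->
  exists2 k, K k & forall f, f (a i) @[i --> U] --> f k.
Proof.
move=> cK Ka; have [k [Kk cl]] := cK (a @ U) (fmap_proper_filter a _) Ka.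
exists k => // f; apply: ultra_near_cvg => e e0 ne.
pose F : set_system X := nbhs (k : weak_space X).
have FF : Filter F := nbhs_filter (k : weak_space X).
have fk : F [set x | `|f x - f k| < e].
  have fk := (weak_cvgP k FF).1 (fun A h => h) f.
  have := (@cvgrPdist_lt _ _ _ F FF (f : X -> R) (f k)).1 fk e e0.
  by apply: filterS => x /=; rewrite distrC.
have [x [/= ex]] := cl _ _ (ne : (a @ U) [set x | e <= `|f x - f k|]) fk.
by rewrite ltNge ex.
Qed.

Lemma weakly_compact_bounded K f : weakly_compact K ->
  exists M, forall x, K x -> `|f x| <= M.
Proof.
move=> cK; apply: contrapT => nb.
have /choice[a Ka] : forall n : nat, exists x, K x /\ n%:R < `|f x|.
  move=> n; apply: contrapT => h; apply: nb; exists n%:R => x Kx.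
  by rewrite leNgt; apply/negP => fx; apply: h; exists x.
have [U [UU oU]] := free_ultrafilter.
have [|k _ /(_ f) fk] := @weakly_compact_cvg K _ U UU a cK.
  by apply: nearW => n; case: (Ka n).
have h : \forall n \near U, `|f (a n)| < `|f k| + 1.
  by apply: (cvgr_norm_lt _ fk); rewrite ltrDl.
have h' : \forall n \near U, `|f k| + 1 <= n%:R by apply: oU; exact: nbhs_infty_ger.
have [n [/= n1 n2]] := filter_ex (filterI h h').
have [_] := Ka n; have := le_lt_trans n2 (Ka n).2; rewrite ltNge (ltW n1)//.
Qed.

Lemma support_fun_has_sup K f : weakly_compact K -> K !=set0 ->
  has_sup (f @` K).
Proof.
move=> cK [x Kx]; have [M fM] := weakly_compact_bounded f cK.
split; [by exists (f x), x|exists M => _ [y Ky <-]].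
by rewrite (le_trans (ler_norm _))// fM.
Qed.

Lemma support_fun_ub K f x : weakly_compact K -> K x -> f x <= support_fun f K.
Proof.
move=> cK Kx; apply: sup_upper_bound; last by exists x.
by apply: support_fun_has_sup => //; exists x.
Qed.

Lemma support_fun_le K f c : K !=set0 -> (forall x, K x -> f x <= c) ->
  support_fun f K <= c.
Proof.
move=> [x Kx] Kc; apply: ge_sup; first by exists (f x), x.
by move=> _ [y Ky <-]; exact: Kc.
Qed.

Lemma support_fun_attained K f : weakly_compact K -> K !=set0 ->
  exists2 x, K x & f x = support_fun f K.
Proof.
move=> cK K0; have hs := support_fun_has_sup f cK K0.
have /choice[a Ka] : forall n : nat, exists x, K x /\
    support_fun f K - n.+1%:R^-1 < f x.
  move=> n; have [|_ [x Kx <-] xs] := sup_adherent (eps := n.+1%:R^-1) _ hs.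
    by rewrite invr_gt0.
  by exists x.
have [U [UU oU]] := free_ultrafilter.
have [|k Kk /(_ f) fk] := @weakly_compact_cvg K _ U UU a cK.
  by apply: nearW => n; case: (Ka n).
exists k => //; apply/eqP; rewrite eq_le support_fun_ub//=.
have h : support_fun f K - n.+1%:R^-1 @[n --> U] --> support_fun f K - 0.
  apply: cvgB; first exact: cvg_cst.
  by apply: cvg_trans (@cvg_harmonic R); exact: cvg_app.
rewrite -[leLHS]subr0; apply: ler_cvg_to h fk _.
by apply: nearW => n; apply: ltW; case: (Ka n).
Qed.

Lemma support_fun_sublinear K : weakly_compact K -> K !=set0 ->
  sublinear (fun f => support_fun f K).
Proof.
move=> cK K0; apply: sublinearP => [f g||t f t0].
- by apply: support_fun_le => // x Kx; rewrite dualE lerD// support_fun_ub.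
- have [x Kx <-] := support_fun_attained (0 : V) cK K0; exact: dual0E.
- apply: support_fun_le => // x Kx.
  by rewrite dualE ler_pM2l// support_fun_ub.
Qed.

Lemma support_fun_mono K L f : weakly_compact L -> K !=set0 -> K `<=` L ->
  support_fun f K <= support_fun f L.
Proof. by move=> cL K0 KL; apply: support_fun_le => // x /KL; exact: support_fun_ub. Qed.

Lemma norm_dual_support K f x : weakly_compact K -> K x ->
  `|f x| <= Num.max (support_fun f K) (support_fun (- f) K).
Proof.
move=> cK Kx; rewrite ler_norml lerNl -dualNE !le_max !support_fun_ub//.
by rewrite orbT.
Qed.

(** Points [a n] of [K n] have an ultralimit inside each [K m], since [a n] lies there for [n >= m];
    these limits agree because functionals separate points. *)
Lemma weakly_compact_nested (K : nat -> set X) :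
  (forall n, weakly_compact (K n)) -> (forall n, K n !=set0) ->
  (forall n, K n.+1 `<=` K n) -> exists x, forall n, K n x.
Proof.
move=> cK K0 Kd; have /choice[a Ka] := K0.
have Kmn m n : (m <= n)%N -> K n `<=` K m.
  move=> /subnK <-; elim: (n - m)%N => // k ih.
  by rewrite addSn; exact: subset_trans (Kd _) ih.
have [U [UU oU]] := free_ultrafilter.
have lim m : exists2 x, K m x & forall f, f (a i) @[i --> U] --> f x.
  apply: weakly_compact_cvg => //; apply: oU; exists m => // n /= mn.
  exact: Kmn (Ka n).
have [x _ xl] := lim 0%N; exists x => m; have [y Ky yl] := lim m.
by rewrite (_ : x = y)//; apply: dual_eq_point => f; exact: cvg_unique (xl f) (yl f).
Qed.

Definition face f K : set X := [set x | K x /\ f x = support_fun f K].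

Lemma weakly_compact_face f K : weakly_compact K -> weakly_compact (face f K).
Proof.
move=> cK; apply/weakly_compact_ultraP => F FU Ff.
have [|k Kk Fk] := (weakly_compact_ultraP K).1 cK F FU.
  by apply: filterS Ff => x [].
exists k => //; split=> //; apply: cvg_unique (Fk f) _ => //.
have : cst (support_fun f K) y @[y --> F] --> support_fun f K by exact: cvg_cst.
apply: cvg_trans; apply: near_eq_cvg.
by apply: filterS Ff => x [_ ->].
Qed.

Lemma face_nonempty f K : weakly_compact K -> K !=set0 -> face f K !=set0.
Proof.
by move=> cK K0; have [x Kx fx] := support_fun_attained f cK K0; exists x.
Qed.

(* The support function of an exposed face is a directional derivative of the
   support function, written as an infimum of difference quotients. *)
Lemma support_fun_face f g K : weakly_compact K -> K !=set0 ->
  support_fun g (face f K) = inf (range (fun n : nat =>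
    n.+1%:R * (support_fun (f + n.+1%:R^-1 *: g) K - support_fun f K))).
Proof.
move=> cK K0; set q := fun n : nat => _.
have cF : weakly_compact (face f K) by exact: weakly_compact_face.
have F0 := face_nonempty f cK K0.
have lbq n : support_fun g (face f K) <= q n.
  apply: support_fun_le => // x [Kx fx].
  rewrite /q mulrC -ler_pdivrMr// lerBrDl -fx mulrC.
  by have := support_fun_ub (f + n.+1%:R^-1 *: g) cK Kx; rewrite !dualE.
apply/eqP; rewrite eq_le; apply/andP; split.
  by apply: lb_le_inf; [exists (q 0%N), 0%N|move=> _ [n _ <-]].
have qlb : has_lbound (range q).
  by exists (support_fun g (face f K)) => _ [n _ <-].
have infq n : inf (range q) <= q n by apply: ge_inf => //; exists n.
(* [a n] maximizes the perturbed functional, which gives [q n <= g (a n)]. The ultralimit [k] of the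
   [a n] lies on the face, and [g k] bounds the infimum from above. *)
have /choice[a Ka] : forall n : nat, exists x, K x /\
    (f + n.+1%:R^-1 *: g) x = support_fun (f + n.+1%:R^-1 *: g) K.
  move=> n; have [x Kx fx] := support_fun_attained (f + n.+1%:R^-1 *: g) cK K0.
  by exists x.
have [M gM] := weakly_compact_bounded g cK.
have qa n : q n <= g (a n).
  have [Kan fan] := Ka n.
  rewrite /q mulrC -ler_pdivlMr// -fan !dualE lerBlDl mulrC lerD2r.
  exact: support_fun_ub.
have [U [UU oU]] := free_ultrafilter.
have [|k Kk ak] := @weakly_compact_cvg K _ U UU a cK.
  by apply: nearW => n; case: (Ka n).
have fk : f k = support_fun f K.
  apply/eqP; rewrite eq_le support_fun_ub//=.
  have h : support_fun f K - n.+1%:R^-1 * (2 * M) @[n --> U] --> support_fun f K - 0 * (2 * M).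
    apply: cvgB; first exact: cvg_cst.
    apply: cvgM; last exact: cvg_cst.
    by apply: cvg_trans (@cvg_harmonic R); exact: cvg_app.
  rewrite -[leLHS]subr0 -(mul0r (2 * M)); apply: ler_cvg_to h (ak f) _.
  apply: nearW => n; have [Kan fan] := Ka n.
  have [y Ky <-] := support_fun_attained f cK K0.
  have := support_fun_ub (f + n.+1%:R^-1 *: g) cK Ky; rewrite -fan !dualE.
  have n0 : 0 < n.+1%:R^-1 :> R by rewrite invr_gt0.
  set r : R := n.+1%:R^-1 in n0 *.
  have := gM _ Ky; have := gM _ Kan; rewrite !ler_norml => /andP[_ h2] /andP[h3 _].
  have : 0 <= r * (M - g (a n)) by rewrite mulr_ge0 ?subr_ge0// ltW.
  have : 0 <= r * (M + g y) by rewrite mulr_ge0 ?(ltW n0)// -lerBlDl sub0r.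
  rewrite /=; lra.
apply: le_trans (support_fun_ub g cF (conj Kk fk) : g k <= _).
by apply: cvg_ge_near (ak g) _; apply: nearW => n; exact: le_trans (infq n) (qa n).
Qed.

End weak_topology.


(** * A weak-star sequential test in WCG spaces *)

Section sequential_test.
Variables (R : realType) (X : completeNormedModType R).
Local Notation V := (dual X).
Implicit Types (f g : V) (x y : X) (K : set X) (l : V -> R).

(** Induction on the functionals: [K] is cut into finitely many strips on which [z] varies by at
    most [d], and each strip gets a net for the remaining functionals. The hypothesis is boundedness
    because strips inherit it, unlike weak compactness. *)
Lemma finite_net K (zs : seq V) (d : R) : 0 < d ->
  (forall z : V, exists M, forall x, K x -> `|z x| <= M) ->
  exists s : seq X, (forall a, a \in s -> K a) /\
    forall x, K x -> exists2 a, a \in s & forall z, z \in zs -> `|z x - z a| <= d.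
Proof.
move=> d0; elim: zs K => [|z zs ih] K bK.
  have [[k Kk]|K0] := pselect (K !=set0); last first.
    by exists [::]; split=> // x Kx; exfalso; apply: K0; exists x.
  by exists [:: k]; split=> [a|x Kx]; [rewrite inE => /eqP->|exists k; rewrite ?inE].
have [M zM] := bK z.
pose C (j : nat) := [set x | K x /\ j%:R * d <= z x + M < j.+1%:R * d].
have /choice[s sP] : forall j, exists s : seq X, (forall a, a \in s -> C j a) /\
    forall x, C j x -> exists2 a, a \in s & forall z, z \in zs -> `|z x - z a| <= d.
  move=> j; apply: ih => w; have [N wN] := bK w.
  by exists N => x [Kx _]; exact: wN.
(* [z x + M] lies between [0] and [M + M], so the strips [0] to [n] cover [K]. *)
pose n := Num.truncn ((M + M) / d).
exists (flatten [seq s j | j <- iota 0 n.+1]); split=> [a /flatten_mapP[j _]|x Kx].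
  by move=> /((sP j).1 a)[].
have := zM _ Kx; rewrite ler_norml => /andP[h1 h2].
have h3 : 0 <= (z x + M) / d by rewrite divr_ge0 ?(ltW d0)// -lerBlDr sub0r.
have /andP[j1 j2] := truncn_itv h3; set j := Num.truncn _ in j1 j2.
have Cjx : C j x.
  by split=> //; rewrite -ler_pdivlMr// j1 -ltr_pdivrMr.
have [a sa az] := (sP j).2 x Cjx.
exists a => [|w].
  apply/flatten_mapP; exists j => //; rewrite mem_iota/= add0n ltnS.
  by apply: le_truncn; rewrite ler_pM2r ?invr_gt0// lerD2r.
rewrite inE => /predU1P[->|]; last exact: az.
have [_ /andP[a1 a2]] := (sP j).1 a sa; have [_ /andP[x1 x2]] := Cjx.
rewrite ler_norml; apply/andP; split.
  by move: a2 x1; rewrite -natr1 mulrDl mul1r; lra.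
by move: a1 x2; rewrite -natr1 mulrDl mul1r; lra.
Qed.

Lemma lin_span_eq0 K f : (forall x, K x -> f x = 0) ->
  forall x, lin_span K x -> f x = 0.
Proof.
move=> fK _ [n [a [k [Kk ->]]]]; rewrite dual_sumr big1// => i _.
by rewrite dual_scaler fK// mulr0.
Qed.

Lemma closure_span_eq0 K f : (forall x, K x -> f x = 0) ->
  forall x, closure (lin_span K) x -> f x = 0.
Proof.
move=> fK x cx; apply/eqP; rewrite -normr_le0; apply/ler_addgt0Pr => e e0.
have [M M0 fM] := dual_bounded f.
have [y [sy]] := cx _ (nbhsx_ballx x (e / M) (divr_gt0 e0 M0)).
rewrite -ball_normE /ball_/= => xy.
rewrite add0r -[f x]subr0 -(lin_span_eq0 fK sy) -dual_subr.
by rewrite (le_trans (fM _))// mulrC -ler_pdivlMr// ltW.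
Qed.

Lemma closure_span_cvg0 K (z : nat -> V) : (forall n, in_ball (z n)) ->
  (forall x, K x -> z n x @[n --> \oo] --> (0 : R)) ->
  forall x, closure (lin_span K) x -> z n x @[n --> \oo] --> (0 : R).
Proof.
move=> zB zK x cx; apply/cvgr0Pnorm_le => e e0.
have [y [[m [a [k [Kk yE]]]]]] := cx _ (nbhsx_ballx x (e / 2) (divr_gt0 e0 (ltr0Sn _ 1))).
rewrite -ball_normE /ball_/= => xy.
have zy : z n y @[n --> \oo] --> (0 : R).
  rewrite yE; elim: (index_enum _) => [|i r ih].
    under eq_cvg do rewrite big_nil dual_app0; exact: cvg_cst.
  have zE n : z n (\sum_(j <- i :: r) a j *: k j) =
      a i * z n (k i) + z n (\sum_(j <- r) a j *: k j) :> R.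
    by rewrite big_cons dual_addr dual_scaler.
  under eq_cvg do rewrite zE.
  have : a i * z n (k i) + z n (\sum_(j <- r) a j *: k j) @[n --> \oo] -->
      a i * 0 + (0 : R).
    by apply: cvgD; [apply: cvgM; [exact: cvg_cst|exact: zK]|exact: ih].
  by rewrite mulr0 addr0.
near=> n.
have zny : `|z n y| <= e / 2.
  by near: n; apply: (cvgr0_norm_le _ zy); rewrite divr_gt0.
rewrite -[x](subrK y) dual_addr (splitr e) (le_trans (ler_normD _ _))//.
by rewrite lerD// (le_trans (zB n _))// ltW.
Unshelve. all: by end_near. Qed.

(** On the functionals killing [s], [l] is dominated by [e * dnorm]. Extend this restriction to a
    [k] dominated everywhere: [l - k] vanishes wherever the evaluations at [s] do, so it is a
    combination of them, that is, evaluation at a point of the span. *)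
Lemma approx_by_span K l e (s : seq X) : scalar l -> 0 <= e ->
  (forall a, a \in s -> K a) ->
  (forall f, in_ball f -> (forall x, x \in s -> f x = 0) -> l f <= e) ->
  exists2 x, lin_span K x & forall f, `|l f - f x| <= e * dnorm f.
Proof.
move=> sl e0 sK le.
pose N f := forall x, x \in s -> f x = 0.
have sp : sublinear (fun f => e * dnorm f).
  have [nD nZ] := dnorm_sublinear X; split=> [f g|t f t0].
    by rewrite -mulrDr ler_wpM2l.
  by rewrite nZ// mulrCA.
have [|||f Nf|k [sk kp kl]] := hahn_banach_extension (N := N) sp sl.
- by move=> x _; exact: dual0E.
- by move=> f g Nf Ng x xs; rewrite dualE Nf// Ng// addr0.
- by move=> t f Nf x xs; rewrite dualE Nf// mulr0.
- have [f0|f0] := eqVneq (dnorm f) 0.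
    have -> : f = 0.
      by apply: dual_ext => x; apply/eqP; rewrite -normr_le0 (le_trans (dnorm_bound f x))// f0 mul0r.
    by rewrite (scalar0 sl) mulr_ge0// dnorm_ge0.
  have fp : 0 < dnorm f by rewrite lt_def f0 dnorm_ge0.
  rewrite -ler_pdivrMr// mulrC -(scalarMl _ _ sl); apply: le => [|x xs].
    apply/dnorm_ball; have [_ nZ] := dnorm_sublinear X.
    by rewrite nZ ?invr_ge0 ?(ltW fp)// mulVf.
  by rewrite dualE Nf// mulr0.
pose ev (i : 'I_(size s)) f := f (tnth (in_tuple s) i).
have [|f fe|a ha] := scalar_kernel_sum (e := ev) _ (scalar_sub sl sk).
- by move=> i t f g; rewrite /ev !dualE.
- rewrite kl ?subrr// => x /(nthP 0)[i si <-].
  by have := fe (Ordinal si); rewrite /ev (tnth_nth 0).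
exists (\sum_i a i *: tnth (in_tuple s) i).
  exists (size s), a, (tnth (in_tuple s)); split=> // i.
  by apply: sK; exact: mem_tnth.
move=> f; rewrite dual_sumr (_ : \sum_i _ = l f - k f); last first.
  by rewrite ha; apply: eq_bigr => i _; rewrite dual_scaler.
rewrite opprB addrC subrK (le_trans (scalar_le_norm f sk kp))//.
have dN : dnorm (- f) = dnorm f.
  have dN g : dnorm (- g) <= dnorm g.
    apply: dnorm_le => [|x]; first exact: dnorm_ge0.
    by rewrite dualE (le_trans (ler_norm _))// normrN dnorm_bound.
  by apply/eqP; rewrite eq_le dN -{1}[f]opprK dN.
by rewrite dN maxxx.
Qed.

Definition represented_in (Y : set X) l := exists2 x, Y x & forall f, l f = f x.

Lemma represented_of_approx K l :
  (forall e, 0 < e -> exists2 x, lin_span K x & forall f, `|l f - f x| <= e * dnorm f) ->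
  represented_in (closure (lin_span K)) l.
Proof.
move=> h.
have /choice[x hx] : forall n : nat, exists x, lin_span K x /\
    forall f, `|l f - f x| <= n.+1%:R^-1 * dnorm f.
  by move=> n; have [|x Kx xf] := h n.+1%:R^-1; [rewrite invr_gt0|exists x].
pose u (n : nat) : R := n.+1%:R^-1.
have xd m n : `|x m - x n| <= u m + u n.
  apply: norm_le_dual => f /dnorm_ball f1; rewrite dual_subr.
  have u0 k : 0 <= u k by rewrite invr_ge0.
  have := le_trans ((hx m).2 f) (ler_piMr (u0 m) f1).
  have := le_trans ((hx n).2 f) (ler_piMr (u0 n) f1).
  rewrite !ler_norml => /andP[h1 h2] /andP[h3 h4] /=.
  lra.
have inv_small (e : R) : 0 < e -> \forall n \near \oo, n.+1%:R^-1 < e.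
  by move=> e0; exact: (cvgr_lt _ (@cvg_harmonic R)).
have /cauchy_cvgP xc : cauchy (x @ \oo).
  apply: cauchy_exP => e e0.
  have [N _ Ne] := inv_small _ (divr_gt0 e0 (ltr0Sn _ 1)).
  exists (x N); exists N => // n /= Nn.
  rewrite -ball_normE /ball_/= (le_lt_trans (xd _ _))// (splitr e) ltrD//.
    by apply: Ne => /=.
  exact: Ne.
have [z xz] := (cvg_ex _).1 xc.
exists z.
  move=> B /xz[N _ NB]; exists (x N); split; first by case: (hx N).
  by apply: NB => /=.
move=> f; apply/eqP; rewrite -subr_eq0 -normr_le0.
have fz : `|l f - f (x n)| @[n --> \oo] --> `|l f - f z|.
  apply: cvg_norm; apply: cvgB; first exact: cvg_cst.
  by apply: continuous_cvg => //; exact: dual_app_continuous.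
have gz : n.+1%:R^-1 * dnorm f @[n --> \oo] --> 0 * dnorm f.
  by apply: cvgM; [exact: cvg_harmonic|exact: cvg_cst].
rewrite -(mul0r (dnorm f)); apply: ler_cvg_to fz gz _.
by apply: nearW => n; case: (hx n).
Qed.

(** * Whitley's alternating choice of functionals and points *)

Section construction.
Variables (K : set X) (pick : seq X -> V) (net : seq V -> nat -> seq X).

(** The state holds the functionals and the points chosen so far. Each stage adds a net of [K]
    adapted to the earlier functionals, then a functional meant to vanish at all points
    collected. *)
Fixpoint whitley_state n : seq V * seq X :=
  if n is m.+1 then
    let s := (whitley_state m).2 ++ net (whitley_state m).1 m in
    (pick s :: (whitley_state m).1, s)
  else ([::], [::]).

Definition whitley_seq n : V := pick (whitley_state n.+1).2.

Lemma whitley_seq_mem j n : (j < n)%N -> whitley_seq j \in (whitley_state n).1.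
Proof.
elim: n => // n ih; rewrite ltnS leq_eqVlt => /predU1P[->|/ih].
  by rewrite inE eqxx.
by rewrite inE => ->; rewrite orbT.
Qed.

Lemma whitley_net_sub n m a : (n <= m)%N ->
  a \in net (whitley_state n).1 n -> a \in (whitley_state m.+1).2.
Proof.
move=> /subnK <- na; elim: (m - n)%N => [|k ih]; first by rewrite /= mem_cat na orbT.
by rewrite addSn/= mem_cat; move: ih => /= ->.
Qed.

Hypothesis netK : forall zs n a, a \in net zs n -> K a.

Lemma whitley_state_sub n a : a \in (whitley_state n).2 -> K a.
Proof. by elim: n => //= n ih; rewrite mem_cat => /orP[/ih|/netK]. Qed.

Hypothesis cK : weakly_compact K.
Hypothesis pick_ball : forall s, (forall a, a \in s -> K a) -> in_ball (pick s).
Hypothesis pick0 : forall s a, (forall a, a \in s -> K a) -> a \in s -> pick s a = 0.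
Hypothesis net_net : forall zs n x, K x ->
  exists2 a, a \in net zs n & forall z, z \in zs -> `|z x - z a| <= n.+1%:R^-1.

(** Otherwise some ultralimit [w] of the functionals is nonzero at [x], and it vanishes at all net
    points. Net points [a n] that approach [x] under the earlier functionals have a weak limit [k]
    in [K], which no [whitley_seq j], hence not [w], distinguishes from [x]. But [w k] is the limit
    of [w (a n) = 0]. *)
Lemma whitley_seq_cvg0 x : K x -> whitley_seq n x @[n --> \oo] --> (0 : R).
Proof.
move=> Kx; apply: contrapT => nc.
have [d d0 hd] : exists2 d : R, 0 < d &
    forall N, exists n, (N <= n)%N /\ d <= `|whitley_seq n x|.
  apply: contrapT => nd; apply: nc; apply/cvgr0Pnorm_lt => d d0.
  apply: contrapT => hd; apply: nd; exists d => // N.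
  apply: contrapT => hN; apply: hd; exists N => // n /= Nn.
  by rewrite ltNge; apply/negP => dn; apply: hN; exists n.
have [phi hphi] := choice hd.
have zB n : in_ball (whitley_seq n).
  by apply: pick_ball => a; exact: whitley_state_sub.
have [U [UU oU]] := free_ultrafilter.
have [|w [wl _]] := dual_ulim (z := fun n => whitley_seq (phi n)) UU (r := 1).
  by move=> n y; rewrite mul1r; exact: zB.
have wx : d <= `|w x|.
  apply: cvg_ge_near (cvg_norm (wl x)) _.
  by apply: nearW => n; case: (hphi n).
have wA n a : a \in net (whitley_state n).1 n -> w a = 0.
  move=> na; apply: cvg_unique (wl a) _ => //.
  apply: cvg_near_cst; apply: oU; exists n => // m /= nm; apply: pick0.
    by move=> b; exact: whitley_state_sub.
  apply: whitley_net_sub na; apply: leq_trans nm _; exact: (hphi m).1.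
have /choice[a ha] : forall n, exists a, a \in net (whitley_state n).1 n /\
    forall z, z \in (whitley_state n).1 -> `|z x - z a| <= n.+1%:R^-1.
  by move=> n; have [a] := net_net (whitley_state n).1 n Kx; exists a.
have [|k Kk ak] := @weakly_compact_cvg _ _ K _ U UU a cK.
  by apply: nearW => n; apply: netK (ha n).1.
have zk j : whitley_seq j k = whitley_seq j x.
  apply/eqP; rewrite eq_sym -subr_eq0 -normr_le0.
  have h : `|whitley_seq j x - whitley_seq j (a n)| @[n --> U] -->
      `|whitley_seq j x - whitley_seq j k|.
    by apply: cvg_norm; apply: cvgB; [exact: cvg_cst|exact: ak].
  have h' : n.+1%:R^-1 @[n --> U] --> (0 : R).
    by apply: cvg_trans (@cvg_harmonic R); exact: cvg_app.
  apply: ler_cvg_to h h' _; apply: oU; exists j.+1 => // n /= jn.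
  by apply: (ha n).2; exact: whitley_seq_mem.
have wk : w k = w x.
  have wx' : whitley_seq (phi n) k @[n --> U] --> w x.
    under eq_cvg do rewrite zk; exact: wl.
  exact: cvg_unique (wl k) wx'.
have wk0 : w k = 0.
  apply: cvg_unique (ak w) _ => //.
  by apply: cvg_near_cst; apply: nearW => n; apply: wA (ha n).1.
by move: wx; rewrite -wk wk0 normr0 leNgt d0.
Qed.

End construction.

(* Whitley's construction from his proof of the Eberlein-Smulian theorem. *)
Lemma represented_or_sequence K l : weakly_compact K -> scalar l ->
  represented_in (closure (lin_span K)) l \/
  exists2 e, 0 < e & exists z : nat -> V,
    [/\ forall n, in_ball (z n), forall n, e <= l (z n) &
        forall x, closure (lin_span K) x -> z n x @[n --> \oo] --> (0 : R)].
Proof.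
move=> cK sl.
have [h|nh] := pselect (forall e, 0 < e -> exists s : seq X,
    (forall a, a \in s -> K a) /\ forall f, in_ball f ->
    (forall x, x \in s -> f x = 0) -> l f <= e).
  left; apply: represented_of_approx => e e0; have [s [sK hs]] := h e e0.
  exact: (approx_by_span sl (ltW e0) sK hs).
right; have [e e0 he] : exists2 e, 0 < e & forall s : seq X,
    (forall a, a \in s -> K a) -> exists f, [/\ in_ball f,
    forall x, x \in s -> f x = 0 & e <= l f].
  apply: contrapT => h; apply: nh => e e0; apply: contrapT => hs.
  apply: h; exists e => // s sK; apply: contrapT => hf; apply: hs.
  exists s; split=> // f fB fs; rewrite leNgt; apply/negP => /ltW ef.
  by apply: hf; exists f.
have /choice[pick hpick] : forall s : seq X, exists f, (forall a, a \in s -> K a) ->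
    [/\ in_ball f, forall x, x \in s -> f x = 0 & e <= l f].
  move=> s; have [sK|] := pselect (forall a, a \in s -> K a); last by exists 0.
  by have [f fP] := he s sK; exists f.
have /choice[net hnet] : forall q : seq V * nat, exists s : seq X,
    (forall a, a \in s -> K a) /\ forall x, K x ->
      exists2 a, a \in s & forall z, z \in q.1 -> `|z x - z a| <= q.2.+1%:R^-1.
  move=> q; apply: finite_net; first by rewrite invr_gt0.
  by move=> z; exact: weakly_compact_bounded.
pose nt zs n := net (zs, n).
have ntK zs n a : a \in nt zs n -> K a by exact: (hnet (zs, n)).1.
exists e => //; exists (whitley_seq pick nt).
have pB s : (forall a, a \in s -> K a) -> in_ball (pick s) by case/hpick.
have zB n : in_ball (whitley_seq pick nt n).
  by apply: pB => a; exact: whitley_state_sub.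
split=> // [n|].
  by have [|_ _] := hpick (whitley_state pick nt n.+1).2; first exact: whitley_state_sub.
apply: closure_span_cvg0 => // x; apply: whitley_seq_cvg0 => //.
- by move=> s a /hpick[_ sa _] /sa.
- by move=> zs n y Ky; exact: (hnet (zs, n)).2.
Qed.

End sequential_test.


(** * Series in spaces without copies of c0 *)

Section uniform_boundedness.
Variables (R : realType) (X : completeNormedModType R).
Local Notation V := (dual X).
Implicit Types (f g : V) (x y : X).

(* Sokal's gliding hump; the completeness of the dual is replaced by an
   ultralimit. *)
Lemma weakly_bounded_bounded (A : set X) :
  (forall f, exists c, forall x, A x -> `|f x| <= c) ->
  exists C, forall x, A x -> `|x| <= C.
Proof.
move=> wA; apply: contrapT => nb.
(* The factor [3 ^+ n] offsets the step size [r n]: the hump at [x n] is at least [n], and the later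
   steps together undo at most half of it. *)
have /choice[x hx] : forall n : nat, exists x, A x /\ 3 ^+ n * n%:R < `|x|.
  move=> n; apply: contrapT => h; apply: nb; exists (3 ^+ n * n%:R) => x Ax.
  by rewrite leNgt; apply/negP => xn; apply: h; exists x.
have /choice[v hv] : forall n, exists v : V, in_ball v /\ v (x n) = `|x n|.
  by move=> n; have [v vB vx] := norming (x n); exists v.
pose r n : R := (3 ^+ n)^-1.
have r0 n : 0 < r n by rewrite invr_gt0 exprn_gt0.
have rS n : r n = 3 * r n.+1 by rewrite /r exprS invfM mulrA divff ?mul1r.
(* The sign of the step is chosen so that the new value at [x m] has modulus at least [r m] times
   the norm of [x m]. *)
pose y := fix y n : V := if n is m.+1 then
  if r m * `|x m| <= `|y m (x m) + r m * v m (x m)|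
  then y m + r m *: v m else y m - r m *: v m else 0.
have yhump n : r n * `|x n| <= `|y n.+1 (x n)|.
  rewrite [y n.+1]/=; case: ifPn => [|h]; first by rewrite !dualE.
  rewrite !dualE; move: h; rewrite -ltNge.
  have [_ ->] := hv n; set t := r n * `|x n|; set s := y n (x n) => h.
  have t0 : 0 <= t by rewrite mulr_ge0// ltW.
  rewrite -normrN opprB; move: h; rewrite ltr_norml => /andP[_ h].
  by rewrite ger0_norm; lra.
have ystep n z : `|y n.+1 z - y n z| <= r n * `|z|.
  have vz : `|r n * v n z| <= r n * `|z|.
    by rewrite normrM gtr0_norm// ler_pM2l//; case: (hv n).
  rewrite [y n.+1]/=; case: ifPn => _; rewrite !dualE addrAC subrr add0r//.
  by rewrite normrN.
have ytail n k z : `|y (n + k)%N z - y n z| <= 3 / 2 * (r n - r (n + k)%N) * `|z|.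
  elim: k => [|k ih]; first by rewrite addn0 !subrr mulr0 mul0r normr0.
  rewrite addnS; apply: le_trans (_ : _ <= 3 / 2 * (r n - r (n + k)%N) * `|z| + r (n + k)%N * `|z|) _.
    rewrite -(subrKA (y (n + k)%N z)) addrC.
    by rewrite (le_trans (ler_normD _ _))// lerD.
  rewrite -mulrDl ler_wpM2r//; rewrite (rS (n + k)%N); lra.
have yB n z : `|y n z| <= 2 * `|z|.
  have := ytail 0%N n z; rewrite add0n dual0E subr0 => /le_trans; apply.
  have r00 : r 0%N = 1 by rewrite /r expr0 invr1.
  rewrite ler_wpM2r//; have := r0 n; rewrite r00; lra.
have [U [UU oU]] := free_ultrafilter.
have [w [wl _]] := dual_ulim UU yB.
have [c wc] := wA w.
have ww n : 2^-1 * n%:R <= c.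
  have [Axn xn] := hx n.
  apply: le_trans (wc _ Axn).
  have h1 : `|w (x n) - y n.+1 (x n)| <= 2^-1 * r n * `|x n|.
    have hl : y m (x n) - y n.+1 (x n) @[m --> U] --> w (x n) - y n.+1 (x n).
      by apply: cvgB; [exact: wl|exact: cvg_cst].
    apply: cvg_norm_le_near hl _; apply: oU; exists n.+1 => // m /= nm.
    rewrite -(subnKC nm); apply: le_trans (ytail _ _ _) _.
    by rewrite ler_wpM2r// (rS n); have := r0 (n.+1 + (m - n.+1))%N; lra.
  have h2 := yhump n.
  have h3 : n%:R <= r n * `|x n|.
    by rewrite -ler_pdivrMl// /r invrK ltW.
  have h4 : `|y n.+1 (x n)| <= `|w (x n)| + `|w (x n) - y n.+1 (x n)|.
    by rewrite -{1}(subKr (w (x n)) (y n.+1 (x n))) ler_normB.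
  lra.
have := ww (Num.truncn (2 * c)).+1; have := truncnS_gt (2 * c); lra.
Qed.

Lemma weakly_compact_norm_bounded (K : set X) : weakly_compact K ->
  exists C, forall x, K x -> `|x| <= C.
Proof.
by move=> cK; apply: weakly_bounded_bounded => f; exact: weakly_compact_bounded.
Qed.

End uniform_boundedness.

(** * Weakly unconditionally Cauchy series and the Bessaga-Pelczynski theorem *)

Section bessaga_pelczynski.
Variables (R : realType) (X : completeNormedModType R).
Local Notation V := (dual X).
Implicit Types (f g : V) (x : nat -> X).

Lemma ler_sum_subseq (b : nat -> R) (phi : nat -> nat) (p q : nat) :
  (forall n, 0 <= b n) -> (forall n, phi n < phi n.+1)%N -> (p <= q)%N ->
  \sum_(p <= i < q) b (phi i) <= \sum_(phi p <= k < phi q) b k.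
Proof.
move=> b0 phiS; have phile m n : (m <= n)%N -> (phi m <= phi n)%N.
  move=> /subnK <-; elim: (n - m)%N => // k ih.
  by rewrite addSn; exact: leq_trans ih (ltnW (phiS _)).
elim: q => [|q ih]; first by rewrite leqn0 => /eqP->; rewrite !big_geq.
rewrite leq_eqVlt => /predU1P[->|]; first by rewrite !big_geq.
rewrite ltnS => pq; rewrite big_nat_recr//=.
rewrite (big_cat_nat (phile _ _ pq) (ltnW (phiS q)))/= lerD ?ih//.
rewrite big_ltn// lerDl; exact: sumr_ge0.
Qed.

(** These are the weakly unconditionally Cauchy series. *)
Definition weakly_summable (x : nat -> X) :=
  forall f, exists C, forall n, \sum_(0 <= i < n) `|f (x i)| <= C.

Lemma weakly_summable_tail x f (e : R) : weakly_summable x -> 0 < e ->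
  exists N, forall p q, (N <= p)%N -> \sum_(p <= i < q) `|f (x i)| <= e.
Proof.
move=> wx e0; have [C hC] := wx f.
have cs : cvgn (series (fun i => `|f (x i)|)).
  apply: nondecreasing_is_cvgn.
    by apply/nondecreasing_seqP => n; rewrite /series/= big_nat_recr//= lerDl.
  by exists C => _ [n _ <-]; exact: hC.
have /cauchy_seriesP/(_ e e0)[[A B] /= [[N1 _ h1] [N2 _ h2]] AB] :
  cauchy (series (fun i => `|f (x i)|) @ \oo) by apply/cauchy_cvgP.
exists (maxn N1 N2) => p q; rewrite geq_max => /andP[p1 p2].
have [qp|pq] := leqP q p; first by rewrite big_geq// ltW.
have := AB (p, q) (conj (h1 _ p1) (h2 _ (leq_trans p2 (ltnW pq)))).
by move=> /= h; apply: le_trans (ltW h); exact: ler_norm.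
Qed.

(** The finite sums with coefficients of modulus at most [1] form a weakly bounded set, hence a
    bounded one; scaling gives the rest. *)
Lemma weakly_summable_finite_bound x : weakly_summable x ->
  exists2 C, 0 < C & forall (a : nat -> R) t p q,
    (forall i, (p <= i < q)%N -> `|a i| <= t) ->
    0 <= t -> `|\sum_(p <= i < q) a i *: x i| <= C * t.
Proof.
move=> wx.
have [f|C hC] := @weakly_bounded_bounded R X [set y | exists (a : nat -> R) p q,
    (forall i, (p <= i < q)%N -> `|a i| <= 1) /\
    y = \sum_(p <= i < q) a i *: x i].
  have [C hC] := wx f; exists C => _ [a [p [q [a1 ->]]]].
  rewrite dual_sumr (le_trans (ler_norm_sum _ _ _))//.
  have [qp|pq] := leqP q p.
    by rewrite big_geq// (le_trans _ (hC 0%N))// big_geq.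
  apply: le_trans (hC q); rewrite [leRHS](big_cat_nat (leq0n p) (ltnW pq))/=.
  rewrite -[leLHS]add0r lerD ?sumr_ge0// ler_sum_nat// => i ipq.
  by rewrite dual_scaler normrM ler_piMl// a1.
exists (`|C| + 1) => [|a t p q at_]; first by rewrite ltr_wpDl.
rewrite le_eqVlt => /predU1P[t0|t0].
  rewrite -t0 mulr0 big_nat big1 ?normr0// => i ipq.
  by have := at_ i ipq; rewrite -t0 normr_le0 => /eqP ->; rewrite scale0r.
have -> : \sum_(p <= i < q) a i *: x i =
    t *: \sum_(p <= i < q) (t^-1 * a i) *: x i.
  rewrite scaler_sumr; apply: eq_bigr => i _.
  by rewrite scalerA mulrA divff ?gt_eqF// mul1r.
rewrite normrZ gtr0_norm// mulrC ler_pM2r//.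
apply: le_trans (_ : _ <= C) _; last first.
  by rewrite (le_trans (ler_norm C))// lerDl.
apply: hC; exists (fun i => t^-1 * a i), p, q; split=> // i /at_ ait.
by rewrite normrM gtr0_norm ?invr_gt0// ler_pdivrMl// mulr1.
Qed.

Lemma weakly_summable_cvg0 x f : weakly_summable x ->
  f (x n) @[n --> \oo] --> (0 : R).
Proof.
move=> wx; apply/cvgr0Pnorm_le => e e0.
have [N hN] := weakly_summable_tail f wx e0.
exists N => // n /= Nn; have := hN n n.+1 Nn.
by rewrite big_nat1.
Qed.

(* Biorthogonality up to a small row sum, by Rosenthal's trick: a norming
   sequence is made null on each [x m] by subtracting an ultralimit. *)
Lemma biorthogonal_subsequence x (d e : R) : weakly_summable x -> 0 < d -> 0 < e ->
  (forall n, d <= `|x n|) ->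
  exists (phi : nat -> nat) (u : nat -> V),
    [/\ forall n, (phi n < phi n.+1)%N, forall n y, `|u n y| <= 2 * `|y|,
        forall n, d / 2 <= u n (x (phi n)) &
        forall i N, (i < N)%N -> \sum_(0 <= j < i) `|u i (x (phi j))| +
          \sum_(i.+1 <= j < N) `|u i (x (phi j))| <= 2 * e].
Proof.
move=> wx d0 e0 dx.
have /choice[v hv] : forall n, exists v : V, in_ball v /\ v (x n) = `|x n|.
  by move=> n; have [v vB vx] := norming (x n); exists v.
have [U [UU oU]] := free_ultrafilter.
have [|w [wl wB]] := dual_ulim (z := v) UU (r := 1).
  by move=> n y; rewrite mul1r; case: (hv n).
pose u n : V := v n - w.
have uB n y : `|u n y| <= 2 * `|y|.
  rewrite !dualE (le_trans (ler_normD _ _))// normrN mulr_natl lerD//.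
    by case: (hv n).
  by rewrite -[leRHS]mul1r.
(* Requirements on the next index [n] after [p]: a large diagonal entry, geometrically small entries
   at the points already passed, and small row tails for the functionals already passed. Each holds
   for [U]-almost every [n]. *)
pose P p n := [/\ (p < n)%N, d / 2 <= u n (x n),
  forall m, (m <= p)%N -> `|u n (x m)| <= e / 2 ^+ m.+1 &
  forall m q, (m <= p)%N -> \sum_(n <= k < q) `|u m (x k)| <= e].
have /choice[nxt hnxt] : forall p, exists n, P p n.
  move=> p.
  have c1 : \forall n \near U, (p < n)%N by apply: oU; exact: nbhs_infty_gt.
  have c2 : \forall n \near U, d / 2 <= u n (x n).
    have wx0 := weakly_summable_cvg0 w wx.
    have : \forall n \near \oo, `|w (x n)| <= d / 2.
      by apply: (cvgr0_norm_le _ wx0); rewrite divr_gt0.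
    move=> /oU; apply: filterS => n; rewrite ler_norml => /andP[_ wn].
    by rewrite !dualE; have [_ ->] := hv n; have := dx n; lra.
  have c3 : \forall n \near U, forall m, (m < p.+1)%N -> `|u n (x m)| <= e / 2 ^+ m.+1.
    elim: p.+1 => [|q ih]; first by apply: nearW.
    have : \forall n \near U, `|u n (x q)| <= e / 2 ^+ q.+1.
      have h : u n (x q) @[n --> U] --> (0 : R).
        rewrite -[0](subrr (w (x q))).
        by apply: cvgB; [exact: wl|exact: cvg_cst].
      by apply: (cvgr0_norm_le _ h); rewrite divr_gt0// exprn_gt0.
    move=> hq; apply: filterS (filterI ih hq) => n [h1 h2] m.
    by rewrite ltnS leq_eqVlt => /predU1P[->//|]; exact: h1.
  have c4 : \forall n \near U, forall m q, (m < p.+1)%N ->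
      \sum_(n <= k < q) `|u m (x k)| <= e.
    elim: p.+1 => [|r ih]; first by apply: nearW.
    have [N hN] := weakly_summable_tail (u r) wx e0.
    have hr : \forall n \near U, (N <= n)%N by apply: oU; exact: nbhs_infty_ge.
    apply: filterS (filterI ih hr) => n [h1 h2] m q.
    by rewrite ltnS leq_eqVlt => /predU1P[->|]; [exact: hN|exact: h1].
  have [n [[h1 h2] [h3 h4]]] := filter_ex (filterI (filterI c1 c2) (filterI c3 c4)).
  by exists n; split=> // m q; exact: h4.
pose phi := fix phi n := if n is m.+1 then nxt (phi m) else nxt 0%N.
have phiS n : (phi n < phi n.+1)%N by have [] := hnxt (phi n).
have phile m n : (m <= n)%N -> (phi m <= phi n)%N.
  move=> /subnK <-; elim: (n - m)%N => // k ih.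
  by rewrite addSn; exact: leq_trans ih (ltnW (phiS _)).
exists phi, (fun n => u (phi n)); split=> // [n|i N iN].
- by case: n => [|n]; [have [_ h _ _] := hnxt 0%N|have [_ h _ _] := hnxt (phi n)]; exact: h.
- rewrite mulr_natl mulr2n lerD//.
    apply: le_trans (_ : _ <= \sum_(0 <= j < i) e / 2 ^+ j.+1) _.
      apply: ler_sum_nat => j /andP[_ ji].
      case: i ji {iN} => // i; rewrite ltnS => ji.
      have [_ _ h _] := hnxt (phi i).
      apply: le_trans (h (phi j) (phile _ _ ji)) _.
      rewrite ler_pM2l// lef_pV2 ?posrE ?exprn_gt0// ler_eXn2l ?ltr1n// ltnS.
      by elim: j {ji} => // j ihj; exact: leq_ltn_trans ihj (phiS j).
    have -> : \sum_(0 <= j < i) e / 2 ^+ j.+1 = e - e / 2 ^+ i.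
      elim: i {iN} => [|i ih]; first by rewrite big_geq// expr0 divr1 subrr.
      by rewrite big_nat_recr//= ih exprS; field; rewrite expf_neq0.
    by rewrite gerBl divr_ge0// ltW// exprn_gt0.
  apply: le_trans (@ler_sum_subseq (fun k => `|u (phi i) (x k)|) _ _ _ _ phiS iN) _ => //.
  by have [_ _ _ h] := hnxt (phi i); exact: h.
Qed.

(** The embedding sends [a] to the sum of the [a i *: y i] along a subsequence. The bound on finite
    sums gives convergence and the upper estimate; testing against the nearly biorthogonal [u i]
    gives the lower one. *)
Lemma weakly_summable_c0 x (d : R) : weakly_summable x -> 0 < d ->
  (forall n, d <= `|x n|) -> contains_copy (c0 R) X.
Proof.
move=> wx d0 dx.
(* Off-diagonal row sums are then at most [d / 8], a quarter of the diagonal bound [d / 2], which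
   leaves room for the lower constant [d / 8] although the [u i] have norm up to [2]. *)
have e0 : 0 < d / 16 by rewrite divr_gt0.
have [phi [u [phiS uB ux usum]]] := biorthogonal_subsequence wx d0 e0 dx.
pose y n := x (phi n).
have wy : weakly_summable y.
  move=> f; have [C hC] := wx f; exists C => n; apply: le_trans (hC (phi n)).
  apply: le_trans (@ler_sum_subseq (fun k => `|f (x k)|) _ _ _ _ phiS (leq0n n)) _ => //.
  by rewrite [leRHS](big_cat_nat (leq0n (phi 0%N)))//= ?lerDr ?sumr_ge0//;
    elim: n => // n ih; exact: leq_trans ih (ltnW (phiS n)).
have [C C0 hC] := weakly_summable_finite_bound wy.
pose s (a : c0 R) n := \sum_(0 <= i < n) a i *: y i.
have c0_cvg (a : c0 R) : a n @[n --> \oo] --> (0 : R) by case: a => a /=; rewrite inE.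
have sc (a : c0 R) : cvgn (s a).
  apply/cauchy_cvgP; apply: cauchy_exP => e ep.
  have eC : 0 < e / (2 * C) by rewrite divr_gt0// mulr_gt0.
  have [N _ hN] := cvgr0_norm_le _ (c0_cvg a) _ eC.
  exists (s a N), N => // n /= Nn; rewrite -ball_normE /ball_/= distrC.
  rewrite /s (big_cat_nat (leq0n N) Nn)/= addrAC subrr add0r.
  apply: le_lt_trans (hC a _ N n _ (ltW eC)) _ => [i /andP[iN _]|].
    exact: hN.
  by rewrite invfM mulrCA [_ * (_ * C^-1)]mulrC -!mulrA mulVf ?gt_eqF//; lra.
pose F (a : c0 R) : X := lim (s a @ \oo).
have Fl : linear F.
  move=> t a b; apply/cvg_lim => //.
  have sE n : s (t *: a + b) n = t *: s a n + s b n.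
    rewrite /s scaler_sumr -big_split/=; apply: eq_bigr => i _.
    by rewrite scalerA -scalerDl.
  rewrite (_ : s _ = fun n => t *: s a n + s b n); last exact/funext.
  by apply: cvgD; [apply: cvgZl_tmp; exact: sc|exact: sc].
pose Fm := GRing.isLinear.Build R (c0 R) X *:%R F Fl.
pose FL : {linear c0 R -> X} := HB.pack F Fm.
exists FL, (d / 8), C; split=> // [|a]; first by rewrite divr_gt0.
apply/andP; split; last first.
  have h : `|s a n| @[n --> \oo] --> `|F a| by apply: cvg_norm; exact: sc.
  apply: cvg_le_near h _; apply: nearW => n.
  apply: hC; last exact: le_trans (normr_ge0 _) (c0_norm_ub a 0%N).
  by move=> i _; exact: c0_norm_ub.
have A0 : 0 <= c0_norm a by exact: le_trans (normr_ge0 _) (c0_norm_ub a 0%N).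
have lower i : `|a i| * (d / 2) - d / 8 * c0_norm a <= 2 * `|F a|.
  have h : `|u i (s a n)| @[n --> \oo] --> `|u i (F a)|.
    by apply: cvg_norm; apply: continuous_cvg; [exact: dual_app_continuous|exact: sc].
  apply: le_trans (uB i (F a)); apply: cvg_ge_near h _.
  exists i.+1 => // N /= iN.
  rewrite /s (big_cat_nat (leq0n i) (ltnW iN))/= (big_ltn iN)/=.
  rewrite !dual_addr !dual_sumr dual_scaler.
  set L := \sum_(0 <= j < i) _; set Rr := \sum_(i.+1 <= j < N) _.
  have hLR : `|L + Rr| <= d / 8 * c0_norm a.
    apply: le_trans (_ : _ <= c0_norm a * (\sum_(0 <= j < i) `|u i (y j)| +
        \sum_(i.+1 <= j < N) `|u i (y j)|)) _; last first.
      by rewrite mulrC ler_wpM2r// (le_trans (usum i N iN))//; lra.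
    rewrite (le_trans (ler_normD _ _))// mulrDr !mulr_sumr.
    by apply: lerD; apply: le_trans (ler_norm_sum _ _ _) _; apply: ler_sum => j _;
      rewrite dual_scaler normrM ler_wpM2r// c0_norm_ub.
  have -> : L + (a i * u i (y i) + Rr) = a i * u i (y i) - - (L + Rr) by ring.
  apply: le_trans (lerB_dist _ _); rewrite normrN lerB// normrM ler_wpM2l//.
  exact: le_trans (ux i) (ler_norm _).
have : c0_norm a * (d / 2) <= 2 * `|F a| + d / 8 * c0_norm a.
  rewrite -ler_pdivlMr ?divr_gt0//; apply: c0_norm_le => i.
  by rewrite ler_pdivlMr ?divr_gt0//; have := lower i; lra.
(* The norm of [a] is unfolded to [c0_norm a], so that [nra] sees a single atom. *)
change (c0_norm a * (d / 2) <= 2 * `|F a| + d / 8 * c0_norm a ->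
  d / 8 * c0_norm a <= `|F a|).
nra.
Qed.

(** If the partial sums are not Cauchy, infinitely many disjoint blocks have norm at least [d]. The
    blocks again form a weakly unconditionally Cauchy series, which yields a copy of [c0]. *)
Theorem bessaga_pelczynski x : ~ contains_copy (c0 R) X -> weakly_summable x ->
  cvgn (fun n => \sum_(0 <= i < n) x i).
Proof.
move=> nc wx; apply: contrapT => ncv.
have [d d0 hd] : exists2 d : R, 0 < d &
    forall N, exists pq : nat * nat, [/\ (N <= pq.1)%N, (pq.1 <= pq.2)%N &
      d <= `|\sum_(pq.1 <= i < pq.2) x i|].
  apply: contrapT => h; apply: ncv; apply/cauchy_cvgP; apply: cauchy_exP => e e0.
  apply: contrapT => h'; apply: h; exists e => // N; apply: contrapT => hN.
  apply: h'; exists (\sum_(0 <= i < N) x i), N => // n /= Nn.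
  rewrite -ball_normE /ball_/= distrC (big_cat_nat (leq0n N) Nn)/= addrAC subrr add0r.
  by rewrite ltNge; apply/negP => en; apply: hN; exists (N, n).
have /choice[g hg] := hd.
pose p := fix p n := if n is m.+1 then (g (p m)).2 else 0%N.
pose y n := \sum_((g (p n)).1 <= i < (g (p n)).2) x i.
apply: nc; apply: (@weakly_summable_c0 y d) => // [f|n]; last by case: (hg (p n)).
have [C hC] := wx f; exists C => n; apply: le_trans (hC (p n)).
elim: n => [|n ih]; first by rewrite !big_geq.
have [h1 h2 _] := hg (p n).
rewrite big_nat_recr//= (big_cat_nat (leq0n (p n)) (leq_trans h1 h2))/= lerD//.
rewrite (big_cat_nat h1 h2)/= /y dual_sumr.
by rewrite (le_trans (ler_norm_sum _ _ _))// lerDr sumr_ge0.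
Qed.

End bessaga_pelczynski.


(** * Simons' inequality *)

Lemma exists_near_inf (R : realType) (T : Type) (S : set T) (v : T -> R) (b e : R) :
  S !=set0 -> (forall c, S c -> b <= v c) -> 0 < e ->
  exists2 c, S c & forall c', S c' -> v c <= v c' + e.
Proof.
move=> [c0 Sc0] vb e0.
have hi : has_inf (v @` S).
  by split; [exists (v c0), c0|exists b => _ [c Sc <-]; exact: vb].
have [_ [c Sc <-] hc] := inf_adherent e0 hi.
exists c => // c' Sc'; apply: le_trans (ltW hc) _; rewrite lerD2r.
by apply: ge_inf; [case: hi|exists c'].
Qed.

Section simons.
Variables (R : realType) (X : completeNormedModType R).
Local Notation V := (dual X).
Implicit Types (f g w : V) (x y : X).
Variable z : nat -> V.
Hypothesis zB : forall n, in_ball (z n).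

(* The weak-star closed absolutely convex hull of the [z k] for [n <= k], written as
   a bipolar. *)
Definition tail_hull n : set V :=
  [set w | forall x t, (forall k, (n <= k)%N -> `|z k x| <= t) -> `|w x| <= t].

Lemma tail_hull_ball n w : tail_hull n w -> in_ball w.
Proof. by move=> hw x; apply: hw => k _; exact: zB. Qed.

Lemma tail_hull_mono m n : (m <= n)%N -> tail_hull n `<=` tail_hull m.
Proof.
by move=> mn w hw x t zt; apply: hw => k nk; apply: zt; exact: leq_trans nk.
Qed.

Lemma tail_hull_self n : tail_hull n (z n).
Proof. by move=> x t; apply. Qed.

Lemma tail_hull_mid n f g : tail_hull n f -> tail_hull n g ->
  tail_hull n (2^-1 *: f + 2^-1 *: g).
Proof.
move=> hf hg x t zt; rewrite !dualE (le_trans (ler_normD _ _))//.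
rewrite !normrM ger0_norm ?invr_ge0//.
by have := hf x t zt; have := hg x t zt; lra.
Qed.

Lemma tail_hull_ulim (U : set_system nat) (UU : UltraFilter U) (y : nat -> V) w x :
  \oo `<=` U -> (forall n, tail_hull n (y n)) -> y n x @[n --> U] --> w x ->
  z n x @[n --> \oo] --> (0 : R) -> w x = 0.
Proof.
move=> oU hy yw z0; apply/eqP; rewrite -normr_le0; apply/ler_addgt0Pr => e e0.
rewrite add0r; apply: cvg_norm_le_near yw _.
have [N _ hN] := cvgr0_norm_le _ z0 e e0.
apply: oU; exists N => // n /= Nn; apply: hy => k nk.
by apply: hN => /=; exact: leq_trans nk.
Qed.

Variables (p l : V -> R) (C e : R).
Hypotheses (sp : sublinear p) (sl : scalar l) (lp : forall f, l f <= p f).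
Hypotheses (pC : forall f, in_ball f -> p f <= C) (e0 : 0 < e).
Hypothesis lz : forall n, e <= l (z n).

Let in_ballN f : in_ball f -> in_ball (- f).
Proof. by move=> fB x; rewrite dualE normrN. Qed.

Let lC f : in_ball f -> `|l f| <= C.
Proof.
move=> fB; apply: le_trans (scalar_le_norm f sl lp) _.
by rewrite ge_max !pC//; exact: in_ballN.
Qed.

Let pr n : R := (2 ^+ n)^-1.
Let pr0 n : 0 < pr n. Proof. by rewrite invr_gt0 exprn_gt0. Qed.
Let prS n : pr n = 2 * pr n.+1.
Proof. by rewrite /pr exprS invfM mulrA divff ?mul1r. Qed.

Let hull n := [set w | tail_hull n w /\ e <= l w].

Lemma simons_step n u : exists c, hull n c /\
  forall c', hull n c' -> p (u + pr n *: c) <= p (u + pr n *: c') + e * (pr n.+1) ^+ 2.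
Proof.
have [pD pZ] := sp.
have [|c hc||c hc cmin] := @exists_near_inf R _ (hull n) (fun c => p (u + pr n *: c))
   (- pr n * C - p (- u)) (e * (pr n.+1) ^+ 2).
- by exists (z n); split; [exact: tail_hull_self|exact: lz].
- have := pD (- u) (u + pr n *: c); rewrite addrA addNr add0r.
  rewrite (pZ _ _ (ltW (pr0 n))).
  have : - C <= p c.
    have := lC (tail_hull_ball hc.1); rewrite ler_norml => /andP[h _].
    exact: le_trans h (lp c).
  move=> h; have := ler_wpM2l (ltW (pr0 n)) h; rewrite mulrN mulNr; lra.
- by rewrite mulr_gt0// exprn_gt0.
by exists c.
Qed.

(* The greedy choice in the proof of Simons' inequality, with dyadic weights:
   [c n] nearly minimizes [p] of the [n]-th partial sum plus the remaining weight on
   one point of the hull. *)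
Lemma simons_sequence : exists (u : V) (c w : nat -> V),
  [/\ forall n, tail_hull n (w n),
      forall n, w n = 2 ^+ n *: (u - \sum_(0 <= k < n) pr k.+1 *: c k) &
      forall n, e / 2 <= 2 ^+ n * (p u - p (\sum_(0 <= k < n) pr k.+1 *: c k))].
Proof.
have /choice[nxt hnxt] : forall q : nat * V, exists c, hull q.1 c /\
    forall c', hull q.1 c' ->
    p (q.2 + pr q.1 *: c) <= p (q.2 + pr q.1 *: c') + e * (pr q.1.+1) ^+ 2.
  by move=> q; exact: simons_step.
pose us := fix us n : V := if n is m.+1 then us m + pr m.+1 *: nxt (m, us m) else 0.
pose c n := nxt (n, us n).
have usE n : us n = \sum_(0 <= k < n) pr k.+1 *: c k.
  by elim: n => [|n ih]; [rewrite big_geq|rewrite big_nat_recr//= -ih].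
have hc n : hull n (c n) by exact: (hnxt (n, us n)).1.
have cmin n c' : hull n c' ->
    p (us n + pr n *: c n) <= p (us n + pr n *: c') + e * (pr n.+1) ^+ 2.
  exact: (hnxt (n, us n)).2.
have pr00 : pr 0%N = 1 by rewrite /pr expr0 invr1.
have p2 n : 2 ^+ n * pr n = 1 by rewrite divff// expf_neq0.
have prD n m : 2 ^+ n * pr (n + m)%N = pr m by rewrite /pr exprD invfM mulrA p2 mul1r.
have tail n m x t : (forall k, (n <= k)%N -> `|z k x| <= t) ->
    `|us (n + m)%N x - us n x| * 2 ^+ n <= (1 - pr m) * t.
  move=> zt; elim: m => [|m ih].
    by rewrite addn0 !subrr normr0 !mul0r pr00 subrr mul0r.
  have ct : `|c (n + m)%N x| <= t.
    by apply: (hc _).1 => k nk; apply: zt; exact: leq_trans (leq_addr _ _) nk.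
  rewrite addnS [us _]/= -/(c _) !dualE addrAC.
  apply: le_trans (_ : (`|us (n + m)%N x - us n x| +
      `|pr (n + m).+1 * c (n + m)%N x|) * 2 ^+ n <= _).
    by rewrite ler_pM2r ?exprn_gt0// ler_normD.
  have prE q : pr (n + m).+1 * q * 2 ^+ n = pr m.+1 * q.
    by rewrite -addnS mulrC mulrA prD.
  rewrite mulrDl normrM gtr0_norm// prE.
  have := ler_wpM2l (ltW (pr0 m.+1)) ct.
  by rewrite (prS m) in ih *; lra.
have ltail n m : (1 - pr m) * e <= 2 ^+ n * (l (us (n + m)%N) - l (us n)).
  elim: m => [|m ih]; first by rewrite addn0 !subrr mulr0 pr00 subrr mul0r.
  have prE q : 2 ^+ n * (pr (n + m).+1 * q) = pr m.+1 * q.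
    by rewrite -addnS mulrA prD.
  rewrite addnS [us _]/= -/(c _) (scalarD _ _ sl) (scalarMl _ _ sl) addrAC mulrDr.
  rewrite prE.
  have := ler_wpM2l (ltW (pr0 m.+1)) (hc (n + m)%N).2.
  by rewrite (prS m) in ih *; lra.
have [U [UU oU]] := free_ultrafilter.
have [|u [ul _]] := dual_ulim (z := us) UU (r := 1).
  move=> n x; have := tail 0%N n x `|x|; rewrite add0n expr0 mulr1 dual0E subr0.
  move=> /(_ (fun k _ => zB k x)) /le_trans; apply.
  by rewrite ler_wpM2r// lerBlDr lerDl ltW.
pose w n := 2 ^+ n *: (u - us n).
have hw n : tail_hull n (w n).
  move=> x t zt; rewrite !dualE.
  have h : 2 ^+ n * (us m x - us n x) @[m --> U] --> 2 ^+ n * (u x - us n x).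
    by apply: cvgM; [exact: cvg_cst|apply: cvgB; [exact: ul|exact: cvg_cst]].
  apply: cvg_norm_le_near h _; apply: oU; exists n => // m /= nm.
  have t0 : 0 <= t by exact: le_trans (normr_ge0 _) (zt n (leqnn n)).
  rewrite normrM ger0_norm ?exprn_ge0// mulrC -(subnKC nm).
  apply: le_trans (tail _ _ _ _ zt) _.
  by rewrite ler_piMl// lerBlDr lerDl ltW.
(* [l] need not be weak-star continuous, so the bound does not pass to the limit directly. Instead
   [w n] is split into a combination of some [c k], on which [l] is large, and [w (n + m)] with
   small weight [pr m], on which [l] is bounded by [C]. *)
have lw n : e <= l (w n).
  apply/ler_addgt0Pr => d d0.
  have C0 : 0 <= C by exact: le_trans (normr_ge0 _) (lC (tail_hull_ball (hw 0%N))).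
  have [m hm] : exists m, pr m * (e + C) <= d.
    have eC : 0 < e + C by rewrite ltr_pwDl.
    have [m _ /(_ m (leqnn m))] := near_infty_natSinv_expn_lt (PosNum (divr_gt0 d0 eC)).
    by rewrite /= div1r ltr_pdivlMr// => /ltW; exists m.
  have wE : w n = pr m *: w (n + m)%N + 2 ^+ n *: (us (n + m)%N - us n).
    apply: dual_ext => x; rewrite !dualE mulrA [pr m * _]mulrC.
    rewrite (_ : 2 ^+ (n + m) * pr m = 2 ^+ n); first by ring.
    by rewrite exprD -mulrA p2 mulr1.
  rewrite wE (scalarD _ _ sl) (scalarMl (pr m) (w (n + m)%N) sl).
  rewrite (scalarMl _ (us (n + m)%N - us n) sl) (scalarB _ _ sl).
  have := ltail n m; have := lC (tail_hull_ball (hw (n + m)%N)).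
  rewrite ler_norml => /andP[h1 _] h2.
  have h3 := ler_wpM2l (ltW (pr0 m)) h1; lra.
have [pD pZ] := sp.
exists u, c, w; split=> // n; first by rewrite -usE.
(* The left side equals [e] for [n = 0]; step [n] loses [e * pr n.+2] through the tolerance, and the
   losses sum to [e / 2]. *)
rewrite -usE; suff : e / 2 + e * pr n.+1 <= 2 ^+ n * (p u - p (us n)).
  by apply: le_trans; rewrite lerDl mulr_ge0// ltW.
elim: n => [|n ih].
  rewrite expr0 mul1r [us 0%N]/= (sublinear0 sp) subr0.
  have -> : e / 2 + e * pr 1 = e by rewrite /pr expr1; field.
  have := lw 0%N; rewrite /w expr0 scale1r [us 0%N]/= subr0 => /le_trans; apply.
  exact: lp.
(* [w n] is an admissible competitor and completes the partial sum exactly to [u], while [us n.+1]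
   is the midpoint of [us n] and [us n + pr n *: c n]. *)
have h1 := cmin n (w n) (conj (hw n) (lw n)).
have h2 : us n + pr n *: w n = u.
  by rewrite /w scalerA mulrC p2 scale1r addrC subrK.
rewrite h2 in h1.
have h3 : p (us n.+1) <= 2^-1 * p (us n) + 2^-1 * p (us n + pr n *: c n).
  have -> : us n.+1 = 2^-1 *: us n + 2^-1 *: (us n + pr n *: c n).
    apply: dual_ext => x; rewrite [us n.+1]/= -/(c n) !dualE (prS n); lra.
  have := pD (2^-1 *: us n) (2^-1 *: (us n + pr n *: c n)).
  by rewrite !pZ ?invr_ge0.
rewrite exprS; set q : R := 2 ^+ n in ih *.
have q0 : 0 < q by rewrite exprn_gt0.
have h4 : q * pr n.+1 = 2^-1.
  by have := p2 n; rewrite (prS n) -/q => h; lra.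
have h5 : 2 * p (us n.+1) <= p (us n) + p u + e * pr n.+1 ^+ 2 by lra.
have h6 := ler_wpM2l (ltW q0) h5.
have h7 : q * (e * pr n.+1 ^+ 2) = 2^-1 * (e * pr n.+1).
  by rewrite -h4; ring.
rewrite mulrDr h7 in h6; have := prS n.+1 => h8; rewrite h8 in ih h6; lra.
Qed.

End simons.


(** * Integrals of support functions *)

Section selection.
Context d (T : measurableType d) (R : realType) (X : completeNormedModType R).
Local Notation V := (dual X).
Implicit Types (f u : V) (c : nat -> V).

(** The difference quotient formula writes the support function of the face as a countable infimum
    of measurable functions. *)
Lemma measurable_support_face (G : T -> set X) f :
  (forall w, weakly_compact (G w)) -> (forall w, G w !=set0) ->
  (forall g : V, measurable_fun setT (fun w => support_fun g (G w))) ->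
  forall g : V, measurable_fun setT (fun w => support_fun g (face f (G w))).
Proof.
move=> cG G0 mG g.
pose q (n : nat) w : R :=
  n.+1%:R * (support_fun (f + n.+1%:R^-1 *: g) (G w) - support_fun f (G w)).
have qE w : support_fun g (face f (G w)) = infs (q ^~ w) 0%N.
  rewrite support_fun_face// /infs /= /sdrop; congr inf.
  by apply/seteqP; split=> [_ [n _ <-]|_ [n _ <-]]; exists n.
under eq_fun do rewrite qE.
apply: measurable_fun_infs => [w _|n].
  exists (support_fun g (face f (G w))) => _ [n _ <-].
  rewrite qE /infs /=; apply: ge_inf; last by exists n.
  exists (support_fun g (face f (G w))) => _ [m _ <-].
  apply: support_fun_le => [|x [Gx fx]]; first exact: face_nonempty.
  rewrite /q mulrC -ler_pdivrMr// lerBrDl -fx mulrC.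
  by have := support_fun_ub (f + m.+1%:R^-1 *: g) (cG w) Gx; rewrite !dualE.
by apply: measurable_funM => //; exact: measurable_funB.
Qed.

(* Maximize [u] on [G w], then [c 0] on the face so obtained, then [c 1], ... *)
Lemma lexicographic_selection (G : T -> set X) u c :
  (forall w, weakly_compact (G w)) -> (forall w, G w !=set0) ->
  (forall g : V, measurable_fun setT (fun w => support_fun g (G w))) ->
  exists s : T -> X, [/\ forall w, G w (s w),
    forall w, u (s w) = support_fun u (G w) &
    forall n, measurable_fun setT (fun w => c n (s w))].
Proof.
move=> cG G0 mG.
pose F := fix F n w := if n is m.+1 then face (c m) (F m w) else face u (G w).
have [cF F0] : (forall n w, weakly_compact (F n w)) /\ (forall n w, F n w !=set0).
  apply/all_and2 => n; apply/all_and2 => w; elim: n => [|n [ih1 ih2]] /=.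
    by split; [exact: weakly_compact_face|exact: face_nonempty].
  by split; [exact: weakly_compact_face|exact: face_nonempty].
have mF n (g : V) : measurable_fun setT (fun w => support_fun g (F n w)).
  by elim: n g => [|n ih] g /=; exact: measurable_support_face.
have /choice[s hs] : forall w, exists x, forall n, F n w x.
  by move=> w; apply: weakly_compact_nested => // n x [].
exists s; split=> [w|w|n]; [by case: (hs w 0%N)|by case: (hs w 0%N)|].
rewrite (_ : (fun w => c n (s w)) = (fun w => support_fun (c n) (F n w)))//.
by apply/funext => w; case: (hs w n.+1).
Qed.

End selection.

(** * Integrals of real functions *)

Section real_integral.
Context d (T : measurableType d) (R : realType).
Variable mu : {measure set T -> \bar R}.
Implicit Types (A : set T) (g h : T -> R).

Lemma integrable_ae_bounded A g (M : R) : measurable A -> (mu A < +oo)%E ->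
  measurable_fun setT g -> {ae mu, forall w, A w -> `|g w| <= M} ->
  mu.-integrable A (EFin \o g).
Proof.
move=> mA fA mg gM; apply/integrableP; split.
  by apply/measurable_EFinP; exact: measurable_funTS.
apply: (@le_lt_trans _ _ (\int[mu]_(x in A) (cst `|M|%:E) x)%E).
  apply: ae_ge0_le_integral => //.
  - by apply: measurableT_comp => //; apply/measurable_EFinP; exact: measurable_funTS.
  - by move=> w _; rewrite lee_fin.
  - apply: filterS gM => w h Aw /=; rewrite lee_fin.
    exact: le_trans (h Aw) (ler_norm _).
by rewrite integral_cst// lte_mul_pinfty.
Qed.

Lemma integrable_addr A g h : measurable A -> mu.-integrable A (EFin \o g) ->
  mu.-integrable A (EFin \o h) -> mu.-integrable A (EFin \o (fun w => g w + h w)).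
Proof.
move=> mA ig ih.
rewrite (_ : _ \o _ = (fun w => (g w)%:E + (h w)%:E)%E)//; exact: integrableD.
Qed.

Lemma integrable_subr A g h : measurable A -> mu.-integrable A (EFin \o g) ->
  mu.-integrable A (EFin \o h) -> mu.-integrable A (EFin \o (fun w => g w - h w)).
Proof.
move=> mA ig ih.
rewrite (_ : _ \o _ = (fun w => (g w)%:E - (h w)%:E)%E)//; exact: integrableB.
Qed.

Lemma integrable_scaler A (k : R) g : measurable A -> mu.-integrable A (EFin \o g) ->
  mu.-integrable A (EFin \o (fun w => k * g w)).
Proof.
move=> mA ig.
rewrite (_ : _ \o _ = (fun w => k%:E * (g w)%:E)%E)//; exact: integrableZl.
Qed.

Lemma Rintegral_fin A g : mu.-integrable A (EFin \o g) -> measurable A ->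
  (\int[mu]_(w in A) g w)%:E = (\int[mu]_(w in A) (g w)%:E)%E.
Proof. by move=> ig mA; rewrite fineK//; exact: integrable_fin_num. Qed.

Lemma le_Rintegral_ae A g h : measurable A ->
  mu.-integrable A (EFin \o g) -> mu.-integrable A (EFin \o h) ->
  {ae mu, forall w, A w -> g w <= h w} ->
  \int[mu]_(w in A) g w <= \int[mu]_(w in A) h w.
Proof.
move=> mA ig ih gh; rewrite -subr_ge0 -RintegralB//.
have ihg : mu.-integrable A (EFin \o (fun w => h w - g w)).
  exact: integrable_subr.
rewrite [leRHS](_ : _ = \int[mu]_(w in A) `|h w - g w|); first exact: Rintegral_ge0.
congr fine; apply: ae_eq_integral => //.
- exact: measurable_int ihg.
- by apply: measurable_int (integrable_norm ihg).
- by apply: filterS gh => w gh Aw; rewrite ger0_norm// subr_ge0 gh.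
Qed.

End real_integral.

(** * The integral of the support function as a sublinear functional *)

Section multifunction.
Context d (T : measurableType d) (R : realType) (X : completeNormedModType R).
Variables (mu : {measure set T -> \bar R}) (G : T -> set X).
Hypotheses (cG : forall w, weakly_compact (G w)) (G0 : forall w, G w !=set0).
Hypothesis iG : scalarly_integrable mu G.
Arguments cG : clear implicits.
Arguments iG : clear implicits.
Local Notation V := (dual X).
Implicit Types (f g : V) (A E : set T) (l : V -> R).

Lemma support_integrable A f : measurable A ->
  mu.-integrable A (EFin \o (fun w => support_fun f (G w))).
Proof. by move=> mA; apply: (integrableS measurableT) (iG f). Qed.

Lemma measurable_support f : measurable_fun setT (fun w => support_fun f (G w)).
Proof. by apply/measurable_EFinP; exact: measurable_int (iG f). Qed.

Definition support_integral A f : R := \int[mu]_(w in A) support_fun f (G w).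

(** This is the maximum of the absolute value of [f] on [G w]. *)
Definition support_norm f w : R :=
  Num.max (support_fun f (G w)) (support_fun (- f) (G w)).

Lemma norm_le_support_norm f w x : G w x -> `|f x| <= support_norm f w.
Proof. exact: norm_dual_support. Qed.

Lemma support_norm_ge0 f w : 0 <= support_norm f w.
Proof. by have [x Gx] := G0 w; exact: le_trans (norm_le_support_norm f Gx). Qed.

Lemma support_norm_ge f w : support_fun f (G w) <= support_norm f w.
Proof. by rewrite le_max lexx. Qed.

Lemma support_normN f w : support_norm (- f) w = support_norm f w.
Proof. by rewrite /support_norm opprK maxC. Qed.

Lemma support_norm_attained f w : exists2 x, G w x & support_norm f w = `|f x|.
Proof.
have [x Gx xf] := support_fun_attained f (cG w) (G0 w).
have [y Gy yf] := support_fun_attained (- f) (cG w) (G0 w).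
rewrite /support_norm; have [h|h] := leP (support_fun f (G w)) (support_fun (- f) (G w)).
  exists y => //; apply/eqP; rewrite eq_le; apply/andP; split.
    by rewrite -yf dualE (le_trans (ler_norm _))// normrN.
  by apply: le_trans (norm_le_support_norm f Gy) _; rewrite /support_norm max_r.
exists x => //; apply/eqP; rewrite eq_le; apply/andP; split.
  by rewrite -xf ler_norm.
by apply: le_trans (norm_le_support_norm f Gx) _; rewrite /support_norm max_l// ltW.
Qed.

Lemma support_norm_le f w M : (forall x, G w x -> `|f x| <= M) ->
  support_norm f w <= M.
Proof. by move=> h; have [x Gx ->] := support_norm_attained f w; exact: h. Qed.

Lemma measurable_support_norm f : measurable_fun setT (support_norm f).
Proof. by apply: measurable_maxr; exact: measurable_support. Qed.

Lemma support_norm_integrable A f : measurable A ->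
  mu.-integrable A (EFin \o support_norm f).
Proof.
move=> mA; have h1 := integrable_norm (support_integrable f mA).
have h2 := integrable_norm (support_integrable (- f) mA).
apply: le_integrable (integrableD mA h1 h2) => //.
  by apply/measurable_EFinP; apply: measurable_funTS; exact: measurable_support_norm.
move=> w _; rewrite /= lee_fin ger0_norm ?support_norm_ge0// ger0_norm//.
rewrite ge_max; apply/andP; split.
  by rewrite (le_trans (ler_norm _))// lerDl.
by rewrite (le_trans (ler_norm _))// lerDr.
Qed.

Lemma support_integral_sublinear A : measurable A ->
  sublinear (support_integral A).
Proof.
move=> mA; apply: sublinearP => [f g||t f t0].
- rewrite /support_integral -RintegralD//; try exact: support_integrable.
  apply: le_Rintegral => // [||w _].
  + exact: support_integrable.
  + by apply: integrable_addr => //; exact: support_integrable.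
  + by have [h _] := support_fun_sublinear (cG w) (G0 w); exact: h.
- rewrite /support_integral (@eq_Rintegral _ _ _ mu A (fun=> 0)) ?Rintegral_cst ?mul0r// => w _.
  by rewrite (sublinear0 (support_fun_sublinear (cG w) (G0 w))).
- rewrite /support_integral -RintegralZl//; last exact: support_integrable.
  rewrite le_eqVlt; apply/orP; left; apply/eqP; apply: eq_Rintegral => w _.
  by have [_ h] := support_fun_sublinear (cG w) (G0 w); rewrite h// ltW.
Qed.

Lemma support_integral_le_norm A f : measurable A ->
  support_integral A f <= \int[mu]_(w in A) support_norm f w.
Proof.
move=> mA; apply: le_Rintegral => // [||w _].
- exact: support_integrable.
- exact: support_norm_integrable.
- exact: support_norm_ge.
Qed.

Lemma norm_le_integral A l f : measurable A -> scalar l ->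
  (forall g, l g <= support_integral A g) ->
  `|l f| <= \int[mu]_(w in A) support_norm f w.
Proof.
move=> mA sl lA; apply: le_trans (scalar_le_norm f sl lA) _.
rewrite ge_max !(le_trans (support_integral_le_norm _ mA))//.
by under eq_Rintegral do rewrite support_normN.
Qed.

End multifunction.


(** * Dominated functionals: the bounded case *)

(** The infima of [Q] over the [Y n] increase to some [S]. Near minimizers taken at stages where the
    infimum is within [eta j / 8] of [S] are close in the sense of [D]; the hypothesis on [D]
    abstracts the parallelogram identity. *)
Lemma nested_minimizers (R : realType) (V : Type) (Y : nat -> set V) (Q : V -> R)
    (D : V -> V -> R) (B : R) (eta : nat -> R) :
  (forall n, Y n !=set0) -> (forall n, Y n.+1 `<=` Y n) ->
  (forall n y, Y n y -> 0 <= Q y <= B) ->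
  (forall n c, (forall y, Y n y -> c <= Q y) ->
    forall y y', Y n y -> Y n y' -> D y y' <= 2 * Q y + 2 * Q y' - 4 * c) ->
  (forall n, 0 < eta n) -> (forall n, eta n.+1 <= eta n) ->
  exists y : nat -> V, forall j, Y j (y j) /\ D (y j) (y j.+1) <= eta j.
Proof.
move=> Y0 YS QB QD eta0 etaS.
have Yle m n : (m <= n)%N -> Y n `<=` Y m.
  move=> /subnK <-; elim: (n - m)%N => // k ih.
  by rewrite addSn; exact: subset_trans (YS _) ih.
pose I n := inf (Q @` Y n).
have hi n : has_inf (Q @` Y n).
  split; first by have [y Yy] := Y0 n; exists (Q y), y.
  by exists 0 => _ [y /QB/andP[h _] <-].
have Ile n y : Y n y -> I n <= Q y.
  by move=> Yy; apply: ge_inf; [case: (hi n)|exists y].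
have Imono m n : (m <= n)%N -> I m <= I n.
  move=> mn; apply: lb_le_inf; first by case: (hi n).
  by move=> _ [y Yy <-]; apply: Ile; exact: Yle mn _ Yy.
have hs : has_sup (range I).
  split; first by exists (I 0%N), 0%N.
  exists B => _ [n _ <-]; have [y Yy] := Y0 n; apply: le_trans (Ile n y Yy) _.
  by have /andP[] := QB n y Yy.
pose S := sup (range I).
have IS n : I n <= S by apply: sup_upper_bound => //; exists n.
have eta8 j : 0 < eta j / 8 by rewrite divr_gt0.
have /choice[nn hnn] : forall j, exists n, S - eta j / 8 < I n.
  by move=> j; have [_ [n _ <-] h] := sup_adherent (eta8 j) hs; exists n.
(* Summation makes the stages monotone, with [nn j <= N j] and [j <= N j]. *)
pose N j := (\sum_(i < j.+1) (nn i).+1)%N.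
have NS j : (N j <= N j.+1)%N by rewrite /N [leqRHS]big_ord_recr/= leq_addr.
have Nnn j : (nn j <= N j)%N.
  by rewrite /N big_ord_recr/= addnS ltnW// ltnS leq_addl.
have Nj j : (j <= N j)%N.
  by elim: j => // j ih; rewrite /N big_ord_recr/= -/(N j) addnS ltnS (leq_trans ih)// leq_addr.
have /choice[y hy] : forall j, exists y, Y (N j) y /\ Q y <= I (N j) + eta j / 8.
  move=> j; have [_ [y Yy <-] h] := inf_adherent (eta8 j) (hi (N j)).
  by exists y; split=> //; exact: ltW.
exists y => j; have [Yj Qj] := hy j; have [Yj' Qj'] := hy j.+1.
split; first exact: Yle (Nj j) _ Yj.
apply: le_trans (QD (N j) (I (N j)) (Ile (N j)) _ _ Yj (Yle _ _ (NS j) _ Yj')) _.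
have := IS (N j); have := IS (N j.+1); have := hnn j; have := Imono _ _ (Nnn j).
have := etaS j; lra.
Qed.

Section bounded_case.
Context d (T : measurableType d) (R : realType) (X : completeNormedModType R).
Variables (mu : {measure set T -> \bar R}) (G : T -> set X).
Hypotheses (cG : forall w, weakly_compact (G w)) (G0 : forall w, G w !=set0).
Hypothesis iG : scalarly_integrable mu G.
Arguments cG : clear implicits.
Arguments iG : clear implicits.
Local Notation V := (dual X).
Implicit Types (f g y : V).
Variables (E : set T) (M : R).
Hypotheses (mE : measurable E) (fE : (mu E < +oo)%E).
Hypothesis EM : forall f, in_ball f ->
  {ae mu, forall w, E w -> support_norm G f w <= M}.
Variables (z : nat -> V) (e : R).
Hypotheses (zB : forall n, in_ball (z n)) (e0 : 0 < e).

Let mass : R := fine (mu E).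
Let mass0 : 0 <= mass. Proof. by rewrite fine_ge0. Qed.

Let cst_integrable (k : R) : mu.-integrable E (EFin \o cst k).
Proof.
apply: (integrable_ae_bounded (M := `|k|)) => //.
by apply: aeW => w _.
Qed.

Lemma support_integral_bounded f : in_ball f -> support_integral mu G E f <= M * mass.
Proof.
move=> fB; apply: le_trans (support_integral_le_norm cG G0 iG f mE) _.
rewrite -(Rintegral_cst mu mE M); apply: le_Rintegral_ae => //.
- exact: support_norm_integrable.
- exact: cst_integrable.
- exact: EM.
Qed.

Lemma selection_integrable (s : T -> X) f : (forall w, G w (s w)) ->
  measurable_fun setT (fun w => f (s w)) ->
  mu.-integrable E (EFin \o (fun w => f (s w))).
Proof.
move=> Gs ms; apply: le_integrable (support_norm_integrable cG G0 iG f mE) => //.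
  by apply/measurable_EFinP; exact: measurable_funTS.
move=> w _; rewrite /= lee_fin [leRHS]ger0_norm ?support_norm_ge0//.
exact: norm_le_support_norm.
Qed.

(** Simons' argument gives [y n = 2 ^+ n *: (u - v n)]. As [s] maximizes [u] on each [G w], [y n]
    along [s] is at least [2 ^+ n] times the difference of the support functions of [u] and [v n].
    The lexicographic choice makes all [c k], hence [y n], measurable along [s]. *)
Lemma selection_bounded_away l : scalar l ->
  (forall f, l f <= support_integral mu G E f) -> (forall n, e <= l (z n)) ->
  exists (s : T -> X) (y : nat -> V), (forall w, G w (s w)) /\
  forall n, [/\ tail_hull z n (y n), measurable_fun setT (fun w => y n (s w)) &
    e / 2 <= \int[mu]_(w in E) y n (s w)].
Proof.
move=> sl lE lz.
have sp := support_integral_sublinear cG G0 iG mE.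
have [u [c [y [hy yE yp]]]] :=
  simons_sequence zB sp sl lE support_integral_bounded e0 lz.
have [s [Gs us ms]] := lexicographic_selection u c cG G0 (measurable_support iG).
pose v n : V := \sum_(0 <= k < n) (2 ^+ k.+1)^-1 *: c k.
have myn n : measurable_fun setT (fun w => y n (s w)).
  have yEs w : y n (s w) = 2 ^+ n * (support_fun u (G w) -
      \sum_(0 <= k < n) (2 ^+ k.+1)^-1 * c k (s w)).
    by rewrite yE !dualE us dual_sumE.
  under eq_fun do rewrite yEs.
  apply: measurable_funM => //; apply: measurable_funB; first exact: measurable_support.
  by apply: measurable_sum => k; exact: measurable_funM.
exists s, y; split=> // n; split=> //.
apply: le_trans (yp n) _; rewrite -/(v n).
have iv := support_integrable iG (v n) mE; have iu := support_integrable iG u mE.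
rewrite /support_integral -RintegralB// -RintegralZl//; last first.
  exact: integrable_subr.
apply: le_Rintegral => //.
- by apply: integrable_scaler => //; exact: integrable_subr.
- exact: selection_integrable.
- move=> w _; rewrite yE -/(v n) dualZE ler_pM2l ?exprn_gt0// !dualE us lerB//.
  exact: support_fun_ub.
Qed.

(** * Hilbert space minimization along a selection *)

Section minimization.
Variable s : T -> X.
Hypothesis Gs : forall w, G w (s w).

(* Values on the selection [s] of functionals in the hulls of the tails of [z]. Near
   minimizers of the [L2] norm over these decreasing convex sets are [L2]-Cauchy by
   the parallelogram identity; their ultralimit vanishes on [K], hence almost
   everywhere along [s], which contradicts the lower bound [e / 2]. *)
Definition candidates n : set V := [set y | [/\ tail_hull z n y,
  measurable_fun setT (fun w => y (s w)) & e / 2 <= \int[mu]_(w in E) y (s w)]].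

Lemma candidates_bounded n y : candidates n y ->
  {ae mu, forall w, E w -> `|y (s w)| <= M}.
Proof.
move=> [hy _ _]; have := EM (tail_hull_ball zB hy); apply: filterS => w h Ew.
by apply: le_trans (h Ew); exact: norm_le_support_norm.
Qed.

Lemma square_integrable (g : T -> R) (c : R) : measurable_fun setT g ->
  {ae mu, forall w, E w -> `|g w| <= c} ->
  mu.-integrable E (EFin \o (fun w => g w ^+ 2)).
Proof.
move=> mg gc; apply: (integrable_ae_bounded (M := c ^+ 2)) => //.
  exact: measurable_funX.
apply: filterS gc => w h Ew; have {}h := h Ew.
have c0 : 0 <= c by exact: le_trans (normr_ge0 _) h.
by rewrite normrX lerXn2r ?nnegrE.
Qed.

Lemma candidates_mid n f g : candidates n f -> candidates n g ->
  candidates n (2^-1 *: f + 2^-1 *: g).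
Proof.
move=> [hf mf ef] [hg mg eg].
have i1 := selection_integrable Gs mf; have i2 := selection_integrable Gs mg.
have j1 : mu.-integrable E (EFin \o (fun w => 2^-1 * f (s w))).
  exact: integrable_scaler.
have j2 : mu.-integrable E (EFin \o (fun w => 2^-1 * g (s w))).
  exact: integrable_scaler.
split; first exact: tail_hull_mid.
  by apply: measurable_funD; exact: measurable_funM.
rewrite (@eq_Rintegral _ _ _ mu E (fun w => 2^-1 * f (s w) + 2^-1 * g (s w)))//.
by rewrite RintegralD// !RintegralZl//; lra.
Qed.

Lemma candidates_diff_bounded n f g : candidates n f -> candidates n g ->
  {ae mu, forall w, E w -> `|f (s w) - g (s w)| <= M + M}.
Proof.
move=> /candidates_bounded hf /candidates_bounded hg.
apply: filterS (filterI hf hg) => w [h1 h2] Ew.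
by rewrite (le_trans (ler_normB _ _))// lerD ?h1 ?h2.
Qed.

Let Q y := \int[mu]_(w in E) (y (s w)) ^+ 2.
Let D f g := \int[mu]_(w in E) (f (s w) - g (s w)) ^+ 2.

Lemma candidates_parallelogram n f g c : candidates n f -> candidates n g ->
  (forall y, candidates n y -> c <= Q y) -> D f g <= 2 * Q f + 2 * Q g - 4 * c.
Proof.
move=> Yf Yg cQ; have Ym := candidates_mid Yf Yg; have := cQ _ Ym.
have [[[_ mf _] [_ mg _]] [_ mm _]] := (Yf, Yg, Ym).
have iF := square_integrable mf (candidates_bounded Yf).
have iG2 := square_integrable mg (candidates_bounded Yg).
have iM := square_integrable mm (candidates_bounded Ym).
have -> : D f g = 2 * Q f + 2 * Q g - 4 * Q (2^-1 *: f + 2^-1 *: g); last lra.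
rewrite /Q -!RintegralZl// -RintegralD//; [|exact: integrable_scaler..].
rewrite -RintegralB//; [|apply: integrable_addr => //|]; try exact: integrable_scaler.
by apply: eq_Rintegral => w _; rewrite !dualE; field.
Qed.

Lemma candidates_Q_bounds n y : candidates n y -> 0 <= Q y <= M ^+ 2 * mass.
Proof.
move=> Yy; have [_ my _] := Yy; apply/andP; split.
  by apply: Rintegral_ge0 => w _; exact: sqr_ge0.
rewrite -(Rintegral_cst mu mE); apply: le_Rintegral_ae => //.
- exact: square_integrable my (candidates_bounded Yy).
- exact: cst_integrable.
- apply: filterS (candidates_bounded Yy) => w h Ew; have {}h := h Ew.
  have M0 : 0 <= M by exact: le_trans (normr_ge0 _) h.
  by rewrite -[leLHS]ger0_norm ?sqr_ge0// normrX lerXn2r ?nnegrE.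
Qed.

Lemma candidates_not_all_nonempty (K : set X) :
  (forall f, (forall x, K x -> f x = 0) ->
    {ae mu, forall w, support_fun f (G w) = 0}) ->
  (forall x, K x -> z n x @[n --> \oo] --> (0 : R)) ->
  (forall n, candidates n !=set0) -> False.
Proof.
move=> KG zK Y0.
(* The weights are scaled so that the integrals of the successive differences add up to at most
   [e / 4], below the lower bound [e / 2]. *)
pose theta (j : nat) : R := e / (8 * (mass + 1)) / 2 ^+ j.
have m1 : 0 < mass + 1 by rewrite ltr_wpDl.
have theta0 j : 0 < theta j by rewrite !divr_gt0// ?exprn_gt0// mulr_gt0.
have thetaS j : theta j = 2 * theta j.+1.
  by rewrite /theta exprS; field; rewrite expf_neq0// gt_eqF.
have [|||j|j|y hy] := @nested_minimizers R V candidates Q D (M ^+ 2 * mass)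
    (fun j => theta j ^+ 2) Y0.
- move=> n y [hy my ey]; split=> //; exact: tail_hull_mono (leqnSn n) _ hy.
- exact: candidates_Q_bounds.
- by move=> n c cQ f g Yf Yg; exact: candidates_parallelogram Yf Yg cQ.
- by rewrite exprn_gt0.
- have h1 := theta0 j; have h2 := theta0 j.+1; have h3 := thetaS j.
  by rewrite ler_sqr ?nnegrE ?(ltW h1) ?(ltW h2)//; lra.
pose dl j w : R := `|y j (s w) - y j.+1 (s w)|.
have dl_ge0 j w : 0 <= dl j w by exact: normr_ge0.
have mdl j : measurable_fun setT (dl j).
  have [[_ m1' _] _] := hy j; have [[_ m2' _] _] := hy j.+1.
  by apply: measurableT_comp => //; exact: measurable_funB.
have idl j : (\int[mu]_(w in E) (dl j w)%:E <= (theta j * (mass + 1))%:E)%E.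
  have [Yj Dj] := hy j; have [Yj' _] := hy j.+1.
  have Yj1 : candidates j (y j.+1).
    have [h1 h2 h3] := Yj'; split=> //; exact: tail_hull_mono (leqnSn j) _ h1.
  have [[_ mj _] [_ mj' _]] := (Yj, Yj').
  have bd := candidates_diff_bounded Yj Yj1.
  have i1 : mu.-integrable E (EFin \o dl j).
    apply: (integrable_ae_bounded (M := M + M)) => //.
    by apply: filterS bd => w h Ew; rewrite normr_id; exact: h.
  have i2 := square_integrable (measurable_funB mj mj') bd.
  rewrite -Rintegral_fin// lee_fin.
  have i3 : mu.-integrable E (EFin \o (fun w => (theta j)^-1 * (y j (s w) - y j.+1 (s w)) ^+ 2)).
    exact: integrable_scaler.
  apply: (@le_trans _ _ (\int[mu]_(w in E) (theta j + (theta j)^-1 * (y j (s w) - y j.+1 (s w)) ^+ 2))).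
    apply: le_Rintegral => //.
      by apply: integrable_addr => //; exact: cst_integrable.
    (* AM-GM: [a <= theta + a ^+ 2 / theta] *)
    move=> w _; rewrite /dl -(@ger0_norm _ (_ ^+ 2)) ?sqr_ge0// normrX.
    set a := `|_|; have a0 : 0 <= a by exact: normr_ge0.
    rewrite -(ler_pM2l (theta0 j)) mulrDr mulVKf ?gt_eqF//.
    have := theta0 j; nra.
  rewrite RintegralD//; last exact: cst_integrable.
  rewrite Rintegral_cst// RintegralZl// -/mass mulrDr mulr1 lerD2l.
  by rewrite ler_pdivrMl// -expr2.
have [U [UU oU]] := free_ultrafilter.
have [|yy [yl _]] := dual_ulim (z := y) UU (r := 1).
  by move=> n x; rewrite mul1r; have [[h _ _] _] := hy n; exact: (tail_hull_ball zB h).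
have yK x : K x -> yy x = 0.
  move=> Kx; apply: (tail_hull_ulim UU oU _ (yl x) (zK x Kx)) => n.
  by have [[]] := hy n.
have yG : {ae mu, forall w, yy (s w) = 0}.
  have h1 := KG yy yK.
  have h2 : {ae mu, forall w, support_fun (- yy) (G w) = 0}.
    by apply: KG => x Kx; rewrite dualE yK// oppr0.
  apply: filterS (filterI h1 h2) => w [h h']; apply/eqP; rewrite -normr_le0.
  apply: le_trans (norm_le_support_norm cG yy (Gs w)) _.
  by rewrite /support_norm h h' maxxx.
have tel n w : `|y 0%N (s w) - y n (s w)| <= \sum_(0 <= j < n) dl j w.
  elim: n => [|n ih]; first by rewrite subrr normr0 big_geq.
  rewrite big_nat_recr//=.
  have -> : y 0%N (s w) - y n.+1 (s w) =
    (y 0%N (s w) - y n (s w)) + (y n (s w) - y n.+1 (s w)) by ring.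
  by apply: le_trans (ler_normD _ _) _; apply: lerD; [exact: ih|exact: lexx].
(* Almost everywhere the [y n (s w)] tend to [0] along [U], so the initial term is bounded by the
   series of the successive differences. *)
have key : {ae mu, forall w, E w ->
    (`|y 0%N (s w)|%:E <= \sum_(0 <= j <oo) (dl j w)%:E)%E}.
  apply: filterS yG => w yw _.
  have dl0 j : (0 <= (dl j w)%:E)%E by rewrite lee_fin dl_ge0.
  have pl n : ((\sum_(0 <= j < n) dl j w)%:E <= \sum_(0 <= j <oo) (dl j w)%:E)%E.
    by rewrite -sumEFin; apply: nneseries_lim_ge => j _ _; exact: dl0.
  case: (\sum_(0 <= j <oo) (dl j w)%:E)%E pl => [r pl|_|pl].
  - rewrite lee_fin -[y 0%N (s w)]subr0 -yw.
    have hl : y 0%N (s w) - y n (s w) @[n --> U] --> y 0%N (s w) - yy (s w).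
      by apply: cvgB; [exact: cvg_cst|exact: yl].
    apply: cvg_norm_le_near hl _; apply: nearW => n.
    by apply: le_trans (tel n w) _; rewrite -lee_fin.
  - exact: leey.
  - by have := pl 0%N; rewrite leeNy_eq.
have [Y00 _] := hy 0%N; have [_ my0 ey0] := Y00.
have iy0 := selection_integrable Gs my0.
have : ((e / 2)%:E <= (e / 4)%:E)%E; last by rewrite lee_fin => h; have := e0; lra.
apply: (@le_trans _ _ (\int[mu]_(w in E) `|y 0%N (s w)|%:E)%E).
  rewrite -Rintegral_fin//; last exact: integrable_norm iy0.
  rewrite lee_fin (le_trans ey0)//; apply: le_trans (ler_norm _) _.
  exact: le_normr_Rintegral.
apply: (@le_trans _ _ (\int[mu]_(w in E) \sum_(0 <= j <oo) (dl j w)%:E)%E).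
  apply: ae_ge0_le_integral => //.
  - apply/measurable_EFinP; apply: measurableT_comp => //.
    exact: measurable_funTS.
  - by move=> w _; apply: nneseries_ge0 => j _ _; rewrite lee_fin dl_ge0.
  - apply: ge0_emeasurable_sum => [j w _ _|j _]; first by rewrite lee_fin dl_ge0.
    by apply/measurable_EFinP; exact: measurable_funTS.
rewrite integral_nneseries//; last 2 first.
  by move=> j; apply/measurable_EFinP; exact: measurable_funTS.
  by move=> j w _; rewrite lee_fin dl_ge0.
apply: lime_le.
  by apply: is_cvg_nneseries => j _ _; apply: integral_ge0 => w _; rewrite lee_fin dl_ge0.
apply: nearW => n; apply: (@le_trans _ _ (\sum_(0 <= j < n) (theta j * (mass + 1))%:E)%E).
  by apply: lee_sum => j _; exact: idl.
rewrite sumEFin lee_fin.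
have -> : \sum_(0 <= j < n) theta j * (mass + 1) = 2 * (theta 0%N - theta n) * (mass + 1).
  elim: n => [|n ih]; first by rewrite big_geq// subrr mulr0 mul0r.
  by rewrite big_nat_recr//= ih (thetaS n); ring.
have -> : e / 4 = 2 * theta 0%N * (mass + 1).
  by rewrite /theta expr0; field; rewrite gt_eqF.
by rewrite ler_pM2r// ler_pM2l// lerBlDr lerDl ltW.
Qed.

End minimization.

Lemma not_bounded_away (K : set X) l :
  (forall f, (forall x, K x -> f x = 0) ->
    {ae mu, forall w, support_fun f (G w) = 0}) ->
  (forall x, K x -> z n x @[n --> \oo] --> (0 : R)) ->
  scalar l -> (forall f, l f <= support_integral mu G E f) ->
  ~ forall n, e <= l (z n).
Proof.
move=> KG zK sl lE lz; have [s [y [Gs hy]]] := selection_bounded_away sl lE lz.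
apply: (candidates_not_all_nonempty Gs KG zK) => n; exists (y n).
by have [h1 h2 h3] := hy n; split.
Qed.

End bounded_case.


(** * Dominated functionals: the general case *)

Section unbounded_case.
Context d (T : measurableType d) (R : realType) (X : completeNormedModType R).
Variables (mu : {measure set T -> \bar R}) (G : T -> set X).
Hypotheses (cG : forall w, weakly_compact (G w)) (G0 : forall w, G w !=set0).
Hypothesis iG : scalarly_integrable mu G.
Arguments cG : clear implicits.
Arguments iG : clear implicits.
Local Notation V := (dual X).
Implicit Types (f g : V) (A E S : set T) (l : V -> R) (N : nat -> V).
Local Notation nu := (support_norm G).

Lemma in_ball0 : in_ball (0 : V).
Proof. by move=> x; rewrite dual0E normr0. Qed.

Definition sup_support N w : R := sups (fun n => nu (N n) w) 0%N.

Lemma support_norm_ubound w : exists C, forall f, in_ball f -> nu f w <= C.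
Proof.
have [C hC] := weakly_compact_norm_bounded (cG w).
exists C => f fB; apply: support_norm_le => // x Gx.
exact: le_trans (fB x) (hC x Gx).
Qed.

Lemma sup_support_has_ubound N w : (forall n, in_ball (N n)) ->
  has_ubound (range (fun n => nu (N n) w)).
Proof.
by move=> NB; have [C hC] := support_norm_ubound w; exists C => _ [n _ <-]; exact: hC.
Qed.

Lemma sup_support_ub N n w : (forall n, in_ball (N n)) -> nu (N n) w <= sup_support N w.
Proof.
move=> NB; rewrite /sup_support /sups /=; apply: sup_upper_bound; last by exists n.
split; first by exists (nu (N n) w), n.
have [C hC] := sup_support_has_ubound w NB.
by exists C => _ [m _ <-]; apply: hC; exists m.
Qed.

Lemma sup_support_le N w c : (forall n, nu (N n) w <= c) -> sup_support N w <= c.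
Proof.
move=> h; rewrite /sup_support /sups /=; apply: ge_sup.
  by exists (nu (N 0%N) w), 0%N.
by move=> _ [m _ <-].
Qed.

Lemma sup_support_ge0 N w : (forall n, in_ball (N n)) -> 0 <= sup_support N w.
Proof.
by move=> NB; apply: le_trans (sup_support_ub 0%N w NB); exact: support_norm_ge0.
Qed.

Lemma measurable_sup_support N : (forall n, in_ball (N n)) ->
  measurable_fun setT (sup_support N).
Proof.
move=> NB; apply: measurable_fun_sups => [w _|n]; first exact: sup_support_has_ubound.
exact: measurable_support_norm iG _.
Qed.

(** A double sequence is enumerated through codes of pairs; an index that codes no pair gives [0],
    which stays in the ball. *)
Definition merge (Ns : nat -> nat -> V) (n : nat) : V :=
  if unpickle n is Some ij then Ns ij.1 ij.2 else 0.

Lemma merge_ball Ns : (forall i n, in_ball (Ns i n)) -> forall n, in_ball (merge Ns n).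
Proof. by move=> NB n; rewrite /merge; case: unpickle => [ij|]; [exact: NB|exact: in_ball0]. Qed.

Lemma sup_support_merge Ns i w : (forall i n, in_ball (Ns i n)) ->
  sup_support (Ns i) w <= sup_support (merge Ns) w.
Proof.
move=> NB; apply: sup_support_le => n.
have -> : Ns i n = merge Ns (pickle (i, n)) by rewrite /merge pickleK.
by apply: sup_support_ub; exact: merge_ball.
Qed.

(* Maximize the integral of a bounded increasing transform of the supremum. *)
Lemma essential_supremum S : measurable S -> (mu S < +oo)%E ->
  exists N, (forall n, in_ball (N n)) /\
  forall f, in_ball f -> {ae mu, forall w, S w -> nu f w <= sup_support N w}.
Proof.
move=> mS fS.
(* Boundedness makes the integrals over [S] finite; strict monotonicity lets equal transforms force
   equal suprema. *)
pose tau (t : R) := 1 - expR (- t).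
have tau_le s t : s <= t -> tau s <= tau t.
  by move=> st; rewrite /tau lerD2l lerN2 ler_expR lerN2.
have tau_lt s t : s < t -> tau s < tau t.
  by move=> st; rewrite /tau ltrD2l ltrN2 ltr_expR ltrN2.
have tau01 t : 0 <= t -> 0 <= tau t <= 1.
  move=> t0; rewrite /tau subr_ge0 -{1}expR0 ler_expR oppr_le0 t0/=.
  by rewrite lerBlDr lerDl expR_ge0.
have mtau N : (forall n, in_ball (N n)) ->
    measurable_fun setT (fun w => tau (sup_support N w)).
  move=> NB; apply: measurable_funB => //; apply: measurableT_comp => //.
  by apply: measurable_funN; exact: measurable_sup_support.
have itau N : (forall n, in_ball (N n)) ->
    mu.-integrable S (EFin \o (fun w => tau (sup_support N w))).
  move=> NB; apply: (integrable_ae_bounded (M := 1)) => //; first exact: mtau.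
  apply: aeW => w _; have /andP[h1 h2] := tau01 _ (sup_support_ge0 w NB).
  by rewrite ger0_norm.
pose J N := \int[mu]_(w in S) tau (sup_support N w).
have J_le N N' : (forall n, in_ball (N n)) -> (forall n, in_ball (N' n)) ->
    (forall w, sup_support N w <= sup_support N' w) -> J N <= J N'.
  move=> NB NB' NN; apply: le_Rintegral => // [||w _]; [exact: itau|exact: itau|].
  exact: tau_le.
pose Js := J @` [set N | forall n, in_ball (N n)].
have hs : has_sup Js.
  split; first by exists (J (fun=> 0)), (fun=> 0) => // n; exact: in_ball0.
  exists (1 * fine (mu S)) => _ [N NB <-].
  rewrite -(Rintegral_cst mu mS); apply: le_Rintegral => // [||w _].
  - exact: itau.
  - by apply: (integrable_ae_bounded (M := 1)) => //; apply: aeW => w _; rewrite normr1.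
  - by have /andP[] := tau01 _ (sup_support_ge0 w NB).
have /choice[Ns hNs] : forall j : nat, exists N, (forall n, in_ball (N n)) /\
    sup Js - j.+1%:R^-1 < J N.
  move=> j; have [|_ [N NB <-] h] := sup_adherent (eps := j.+1%:R^-1) _ hs.
    by rewrite invr_gt0.
  by exists N.
have NsB i n : in_ball (Ns i n) by exact: (hNs i).1.
pose N := merge Ns; have NB n : in_ball (N n) by exact: merge_ball.
have JN : sup Js <= J N.
  apply/ler_addgt0Pr => e e0.
  have [j _ /(_ j (leqnn j)) hj] := near_infty_natSinv_lt (PosNum e0).
  rewrite -lerBlDr; apply: le_trans (J_le _ _ (NsB j) NB (fun w => sup_support_merge j w NsB)).
  by apply: le_trans (ltW (hNs j).2); rewrite lerD2l lerN2; exact: ltW hj.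
exists N; split=> // f fB.
(* Adjoining [f] cannot increase [J], so almost everywhere on [S] the two transforms agree and
   [nu f] does not exceed the old supremum. *)
pose N' n := if n is m.+1 then N m else f.
have N'B n : in_ball (N' n) by case: n.
have NN' w : sup_support N w <= sup_support N' w.
  by apply: sup_support_le => n; exact: (sup_support_ub n.+1 w N'B).
have JN' : J N' = J N.
  apply: le_anti; apply/andP; split; last exact: J_le NB N'B NN'.
  by apply: le_trans JN; apply: sup_upper_bound; [exact: hs|exists N'].
pose D w := tau (sup_support N' w) - tau (sup_support N w).
have D0 w : 0 <= D w.
  by rewrite subr_ge0; exact: tau_le.
have mD : measurable_fun S (EFin \o D).
  apply/measurable_EFinP; apply: measurable_funTS.
  by apply: measurable_funB; exact: mtau.
have iD : mu.-integrable S (EFin \o D).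
  exact: integrable_subr mS (itau N' N'B) (itau N NB).
have DI : \int[mu]_(w in S) D w = 0.
  rewrite (@RintegralB _ _ _ mu S (fun w => tau (sup_support N' w))
    (fun w => tau (sup_support N w)) mS (itau N' N'B) (itau N NB)).
  by rewrite -/(J N') -/(J N) JN' subrr.
have DE w : D w = 0 -> tau (sup_support N' w) = tau (sup_support N w).
  by move/eqP; rewrite subr_eq0 => /eqP.
clearbody D.
have : (\int[mu]_(w in S) `|(EFin \o D) w| = 0)%E.
  have EE : (\int[mu]_(w in S) `|(EFin \o D) w|)%E = (\int[mu]_(w in S) (D w)%:E)%E.
    by apply: eq_integral => w _; rewrite /comp abse_EFin (ger0_norm (D0 w)).
  by rewrite EE -(Rintegral_fin iD mS) DI.
move/(ae_eq_integral_abs mu mS mD); apply: filterS => w h Sw.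
have tt := DE w (EFin_inj (h Sw)).
apply: le_trans (sup_support_ub 0%N w N'B) _; rewrite leNgt; apply/negP => lt.
by have := tau_lt _ _ lt; rewrite tt ltxx.
Qed.

Lemma Rintegral_split A E E' (h : T -> R) : measurable A -> measurable E ->
  measurable E' -> E `<=` E' -> mu.-integrable A (EFin \o h) ->
  \int[mu]_(w in A `\` E) h w =
    \int[mu]_(w in A `&` (E' `\` E)) h w + \int[mu]_(w in A `\` E') h w.
Proof.
move=> mA mE mE' EE' ih.
have -> : A `\` E = (A `&` (E' `\` E)) `|` (A `\` E').
  apply/seteqP; split=> [w [Aw nEw]|w [[Aw [_ nEw]]|[Aw nE'w]]]; [|by []|].
    by have [E'w|nE'w] := pselect (E' w); [left|right].
  by split=> // /EE'.
apply: Rintegral_setU.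
- by apply: measurableI => //; exact: measurableD.
- exact: measurableD.
- apply: integrableS ih => //; last by move=> w [[]|[]].
  by apply: measurableU; [apply: measurableI => //|]; exact: measurableD.
- apply/disj_setPS => w [[_ [E'w _]] [_ nE'w]]; exact: nE'w.
Qed.

Section main.
Variables (A : set T) (K : set X).
Hypotheses (mA : measurable A) (cK : weakly_compact K).
Hypothesis KG : forall f, (forall x, K x -> f x = 0) ->
    {ae mu, forall w, support_fun f (G w) = 0}.
Hypothesis no_c0 : ~ contains_copy (c0 R) X.
Arguments cK : clear implicits.

Lemma bounded_represented E M l : measurable E -> (mu E < +oo)%E ->
  (forall f, in_ball f -> {ae mu, forall w, E w -> nu f w <= M}) ->
  scalar l -> (forall f, l f <= support_integral mu G E f) ->
  represented_in (closure (lin_span K)) l.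
Proof.
move=> mE fE EM sl lE.
have [//|[e e0 [z [zB lz zK]]]] := represented_or_sequence cK sl.
exfalso; apply: (not_bounded_away cG G0 iG mE fE EM zB e0 KG _ sl lE lz) => x Kx.
by apply: zK; apply: subset_closure; exists 1%N, (fun=> 1), (fun=> x); rewrite big_ord1 scale1r.
Qed.

(** [S k], where [k] times the sum of the first [k] support norms is at least [1], has finite
    measure by Markov's inequality. [H] dominates, almost everywhere on each [S k], the support norm
    of every functional of the dual ball, and [E k] is the part of [S k] where [H] is at most
    [k]. *)
Lemma exhaustion (z : nat -> V) : exists E : nat -> set T,
  [/\ E 0%N = set0, forall k, measurable (E k), forall k, E k `<=` E k.+1,
      forall k, (mu (E k) < +oo)%E &
      (forall k f, in_ball f -> {ae mu, forall w, E k w -> nu f w <= k%:R}) /\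
      (forall n w, ~ (\bigcup_k E k) w -> nu (z n) w = 0)].
Proof.
pose sg k w : R := k%:R * \sum_(0 <= n < k) nu (z n) w.
have sg_ge0 k w : 0 <= \sum_(0 <= n < k) nu (z n) w.
  by apply: sumr_ge0 => n _; exact: support_norm_ge0.
have isg k : mu.-integrable setT (EFin \o sg k).
  apply: integrable_scaler => //; elim: k => [|k ih].
    rewrite (_ : _ \o _ = cst 0%E); first exact: integrable0.
    by apply/funext => w; rewrite /= big_geq.
  rewrite (_ : _ \o _ = EFin \o (fun w => \sum_(0 <= n < k) nu (z n) w + nu (z k) w)).
    by apply: integrable_addr => //; exact: support_norm_integrable.
  by apply/funext => w; rewrite /= big_nat_recr.
have msg k : measurable_fun setT (sg k).
  by apply/measurable_EFinP; exact: measurable_int (isg k).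
pose S k := [set w | 1 <= sg k w].
have mS k : measurable (S k).
  rewrite -[S k]setTI; apply: (@measurable_fun_le _ _ _ setT (cst 1) (sg k)) => //.
have fS k : (mu (S k) < +oo)%E.
  have := le_integral_abse mu measurableT (measurable_int mu (isg k)) ltr01.
  rewrite mul1e setTI (_ : [set x | _] = S k).
    by move=> /le_lt_trans; apply; case/integrableP : (isg k).
  apply/seteqP; split=> w; rewrite /= lee_fin ger0_norm ?mulr_ge0//.
have /choice[Ns hNs] := fun k => essential_supremum (mS k) (fS k).
have NsB i n : in_ball (Ns i n) by exact: (hNs i).1.
pose H := sup_support (merge Ns).
have mH : measurable_fun setT H by apply: measurable_sup_support; exact: merge_ball.
pose E k := S k `&` [set w | H w <= k%:R].
have mE k : measurable (E k).
  apply: measurableI => //; rewrite -[X in measurable X]setTI.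
  exact: (@measurable_fun_le _ _ _ setT H (cst k%:R)).
have sgS k w : sg k w <= sg k.+1 w.
  rewrite /sg big_nat_recr//=; apply: ler_pM => //; first by rewrite ler_nat.
  by rewrite lerDl; exact: support_norm_ge0.
exists E; split=> //.
- by apply/seteqP; split=> // w [/=]; rewrite /S/= /sg mul0r leNgt ltr01.
- move=> k w [/= h1 h2]; split; first exact: le_trans h1 (sgS k w).
  by rewrite /= (le_trans h2)// ler_nat.
- move=> k; apply: le_lt_trans (fS k); apply: le_measure; rewrite ?inE//.
  by move=> w [].
split=> [k f fB|n w nE].
  apply: filterS ((hNs k).2 f fB) => w h [Sw Hw].
  by apply: le_trans (h Sw) _; apply: le_trans (sup_support_merge k w NsB) Hw.
apply/eqP; rewrite eq_le support_norm_ge0// andbT leNgt; apply/negP => zw.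
pose a := nu (z n) w.
(* The three terms ensure that [n] occurs in the sum, that [H w <= k], and that [k * a >= 1]. *)
pose k := maxn n.+1 (maxn (Num.truncn (H w)).+1 (Num.truncn a^-1).+1).
apply: nE; exists k => //; split.
  have k1 : (n < k)%N by rewrite /k leq_max leqnn.
  have k2 : a^-1 <= k%:R.
    apply: (ltW (lt_le_trans (truncnS_gt _) _)).
    by rewrite ler_nat /k !leq_max leqnn !orbT.
  rewrite /S/= /sg; apply: le_trans (_ : _ <= k%:R * a) _.
    by rewrite -ler_pdivrMr// div1r.
  rewrite ler_wpM2l// (big_cat_nat (leq0n n) (ltnW k1))/= (big_ltn k1).
  rewrite addrCA lerDl addr_ge0// sumr_ge0// => i _; exact: support_norm_ge0.
rewrite /=; apply: (ltW (lt_le_trans (truncnS_gt _) _)).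
by rewrite ler_nat /k !leq_max leqnn !orbT.
Qed.

Lemma exhaustion_cvg0 (E : nat -> set T) f : (forall k, measurable (E k)) ->
  (forall k, E k `<=` E k.+1) -> E 0%N = set0 ->
  (forall w, ~ (\bigcup_k E k) w -> nu f w = 0) ->
  \int[mu]_(w in A `\` E j) nu f w @[j --> \oo] --> (0 : R).
Proof.
move=> mE ES E0 Ef.
have iA := support_norm_integrable cG G0 iG f mA.
have mU : measurable (\bigcup_k E k) by exact: bigcup_measurable.
have split0 E' : measurable E' -> \int[mu]_(w in A `\` E') nu f w =
    \int[mu]_(w in A) nu f w - \int[mu]_(w in A `&` E') nu f w.
  move=> mE'; have := Rintegral_split mA measurable0 mE' (@sub0set _ _) iA.
  by rewrite !setD0 => ->; rewrite addrAC subrr add0r.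
have IU : \int[mu]_(w in A `&` \bigcup_k E k) nu f w = \int[mu]_(w in A) nu f w.
  apply/esym/eqP; rewrite -subr_eq0 -split0//; apply/eqP.
  rewrite (@eq_Rintegral _ _ _ mu _ (fun=> 0)) ?Rintegral_cst ?mul0r//.
    exact: measurableD.
  by move=> w /set_mem[_ nw]; exact: Ef.
have cv : (\int[mu]_(w in A `&` E j) (nu f w)%:E)%E @[j --> \oo] -->
    (\int[mu]_(w in \bigcup_j (A `&` E j)) (nu f w)%:E)%E.
  apply: ge0_nondecreasing_set_cvg_integral => [|j|j|j w _].
  - by apply/nondecreasing_seqP => j; rewrite subsetEset; exact: setIS.
  - exact: measurableI.
  - apply/measurable_EFinP; apply: measurable_funTS; exact: measurable_support_norm iG _.
  - by rewrite lee_fin support_norm_ge0.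
rewrite -setI_bigcupr -Rintegral_fin ?IU in cv; last 2 first.
- by apply: integrableS iA => //; exact: measurableI.
- exact: measurableI.
have h : \int[mu]_(w in A) nu f w - \int[mu]_(w in A `&` E j) nu f w @[j --> \oo] -->
    \int[mu]_(w in A) nu f w - \int[mu]_(w in A) nu f w.
  by apply: cvgB; [exact: cvg_cst|exact: fine_cvg cv].
rewrite subrr in h; under eq_cvg do rewrite split0//.
exact: h.
Qed.

(* [l] is split by the sandwich theorem along the sets [E j.+1 `\` E j]; the pieces
   are points of [X], and they add up to a point because [X] contains no [c0]. *)
Theorem dominated_represented l : scalar l ->
  (forall f, l f <= support_integral mu G A f) ->
  represented_in (closure (lin_span K)) l.
Proof.
move=> sl lA.
have [//|[e e0 [z [zB lz zK]]]] := represented_or_sequence cK sl; exfalso.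
have [E [E0 mE ES fE [EM Ez]]] := exhaustion z.
pose B j := A `&` (E j.+1 `\` E j).
have mB j : measurable (B j) by apply: measurableI => //; exact: measurableD.
have mAE j : measurable (A `\` E j) by exact: measurableD.
have step (q : nat * (V -> R)) : exists k : V -> R, scalar q.2 ->
    (forall f, q.2 f <= support_integral mu G (A `\` E q.1) f) ->
    [/\ scalar k, forall f, k f <= support_integral mu G (B q.1) f &
      forall f, q.2 f - k f <= support_integral mu G (A `\` E q.1.+1) f].
  case: q => j r /=; have [sr|] := pselect (scalar r); last by exists r.
  have [rA|] := pselect (forall f, r f <= support_integral mu G (A `\` E j) f); last by exists r.
  have [|k hk] := sublinear_sandwich (support_integral_sublinear cG G0 iG (mB j))
    (support_integral_sublinear cG G0 iG (mAE j.+1)) sr; last by exists k.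
  move=> f; apply: le_trans (rA f) _.
  rewrite /support_integral (Rintegral_split mA (mE j) (mE j.+1))//.
  exact: support_integrable.
have /choice[nxt hnxt] := step.
(* [rho j] is what remains of [l] after [j] pieces are removed; it is dominated by the integral over
   the part of [A] outside [E j]. *)
pose rho := fix rho j : V -> R :=
  if j is i.+1 then fun f => rho i f - nxt (i, rho i) f else l.
have [srho rhoA] : (forall j, scalar (rho j)) /\
    (forall j f, rho j f <= support_integral mu G (A `\` E j) f).
  apply/all_and2; elim=> [|j [ih1 ih2]]; first by split=> //; rewrite E0 setD0.
  have [h1 h2 h3] := hnxt (j, rho j) ih1 ih2.
  by split; [exact: scalar_sub|exact: h3].
pose k j := nxt (j, rho j).
have hk j : scalar (k j) /\ forall f, k j f <= support_integral mu G (B j) f.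
  by have [h1 h2 h3] := hnxt (j, rho j) (srho j) (rhoA j).
have rhoE j f : l f = \sum_(0 <= i < j) k i f + rho j f.
  elim: j => [|j ->]; first by rewrite big_geq// add0r.
  by rewrite big_nat_recr//= -/(k j) -addrA; congr (_ + _); rewrite addrC subrK.
have /choice[x hx] : forall j, exists x, closure (lin_span K) x /\ forall f, k j f = f x.
  move=> j; have [sk kB] := hk j.
  have [||x Kx xk] := bounded_represented (M := j.+1%:R) (mB j) _ _ sk kB.
  - apply: le_lt_trans (fE j.+1); apply: le_measure; rewrite ?inE//.
    by move=> w [_ []].
  - by move=> f fB; apply: filterS (EM j.+1 f fB) => w h [_ [Ew _]]; exact: h.
  - by exists x.
have sumB n f : \sum_(0 <= j < n) \int[mu]_(w in B j) nu f w +
    \int[mu]_(w in A `\` E n) nu f w = \int[mu]_(w in A) nu f w.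
  elim: n => [|n ih]; first by rewrite big_geq// add0r E0 setD0.
  rewrite big_nat_recr//= -addrA -Rintegral_split//.
  exact: support_norm_integrable.
(* The [B j] are disjoint parts of [A], so the integrals of [nu f] over them add up to at most the
   integral over [A]. *)
have wx : weakly_summable x.
  move=> f; exists (\int[mu]_(w in A) nu f w) => n; rewrite -(sumB n f).
  apply: le_trans (_ : _ <= \sum_(0 <= j < n) \int[mu]_(w in B j) nu f w) _.
    apply: ler_sum => j _; rewrite -(hx j).2; have [sk kB] := hk j.
    exact: norm_le_integral (mB j) sk kB.
  by rewrite lerDl; apply: Rintegral_ge0 => w _; exact: support_norm_ge0.
have [y xy] := (cvg_ex _).1 (bessaga_pelczynski no_c0 wx).
(* The remainders tend to [0] at each [z n], because [nu (z n)] vanishes outside the exhaustion. *)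
have ly n : l (z n) = z n y.
  have h1 : \sum_(0 <= i < j) k i (z n) @[j --> \oo] --> z n y.
    have hE j : \sum_(0 <= i < j) k i (z n) = z n (\sum_(0 <= i < j) x i).
      by rewrite dual_sumr; apply: eq_bigr => i _; exact: (hx i).2.
    under eq_cvg do rewrite hE.
    by apply: continuous_cvg => //; exact: dual_app_continuous.
  have h2 : rho j (z n) @[j --> \oo] --> (0 : R).
    have h3 := exhaustion_cvg0 mE ES E0 (Ez n).
    apply/cvgr0Pnorm_le => r r0.
    have h3r : \forall j \near \oo, `|\int[mu]_(w in A `\` E j) nu (z n) w| <= r.
      exact: (cvgr0_norm_le _ h3).
    apply: filterS h3r => j; apply: le_trans; apply: le_trans (ler_norm _).
    exact: norm_le_integral (mAE j) (srho j) (rhoA j).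
  have h3 : \sum_(0 <= i < j) k i (z n) + rho j (z n) @[j --> \oo] --> z n y + 0.
    exact: cvgD.
  rewrite addr0 in h3.
  have h4 : \sum_(0 <= i < j) k i (z n) + rho j (z n) @[j --> \oo] --> l (z n).
    by under eq_cvg do rewrite -rhoE; exact: cvg_cst.
  exact: cvg_unique h4 h3.
have zx (m : nat) : z n (\sum_(0 <= i < m) x i) @[n --> \oo] --> (0 : R).
  elim: m => [|m ih].
    under eq_cvg do rewrite big_geq// dual_app0; exact: cvg_cst.
  under eq_cvg do rewrite big_nat_recr//= dual_addr.
  have h : z n (\sum_(0 <= i < m) x i) + z n (x m) @[n --> \oo] --> (0 + 0 : R).
    by apply: cvgD; [exact: ih|apply: zK; exact: (hx m).1].
  by rewrite addr0 in h.
(* Two errors of [e / 4], from the tail of the series and from [z n] on a partial sum, give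
   [l (z n) <= e / 2], against [e <= l (z n)]. *)
have e4 : 0 < e / 4 by rewrite divr_gt0.
have [m _ /(_ m (leqnn m)) /= yN] := (cvgrPdist_le _ _).1 xy _ e4.
have [n _ /(_ n (leqnn n)) /= znN] := cvgr0_norm_le _ (zx m) _ e4.
have := lz n; rewrite ly -[y](subrK (\sum_(0 <= i < m) x i)) dual_addr.
have := le_trans (zB n (y - \sum_(0 <= i < m) x i)) yN.
by move: znN; rewrite !ler_norml => /andP[_ h1] /andP[_ h2]; lra.
Qed.

End main.
End unbounded_case.


(** * Integrals of fuzzy mappings *)

Section support_set.
Variables (R : realType) (X : completeNormedModType R).
Local Notation V := (dual X).
Variable p : V -> R.
Hypothesis sp : sublinear p.
Hypothesis p_eval : forall l : V -> R, scalar l -> (forall f, l f <= p f) ->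
  exists x : X, forall f, l f = f x.

Definition dominated_points : set X := [set x | forall f : V, f x <= p f].

(** Hahn-Banach at [f] gives a linear functional below [p] and equal to it at [f]; [p_eval] makes it
    a point. *)
Lemma dominated_points_attain (f : V) : exists2 x, dominated_points x & f x = p f.
Proof.
have [l [sl lp lf]] := hahn_banach_at f sp; have [x xl] := p_eval sl lp.
by exists x => [g|]; rewrite -xl.
Qed.

(** Along an ultrafilter on the set, the evaluations converge to a linear functional still below
    [p], which [p_eval] turns into a point of the set. *)
Lemma dominated_points_weakly_compact : weakly_compact dominated_points.
Proof.
apply/weakly_compact_ultraP => F FU FW.
have /choice[l hl] : forall f : V, exists r : R, f x @[x --> F] --> r.
  move=> f; apply: (@ultra_bounded_cvg _ _ _ _ (f : X -> R) (Num.max (p f) (p (- f)))).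
  apply: filterS FW => x Wx; rewrite ler_norml lerNl -dualNE !le_max !Wx.
  by rewrite orbT.
have sl : scalar l.
  move=> t f g; have h : (t *: f + g) x @[x --> F] --> t * l f + l g.
    under eq_cvg do rewrite !dualE.
    by apply: cvgD => //; apply: cvgM => //; exact: cvg_cst.
  exact: cvg_unique (hl (t *: f + g)) h.
have lp f : l f <= p f.
  by apply: cvg_le_near (hl f) _; apply: filterS FW => x Wx; exact: Wx.
have [x xl] := p_eval sl lp.
exists x => f; first by rewrite -xl; exact: lp.
by rewrite -xl; exact: hl.
Qed.

Lemma dominated_points_cwk : cwk dominated_points.
Proof.
split; [|move=> x y t /set_mem Wx /set_mem Wy; apply/mem_set => f|].
- by have [x Wx _] := dominated_points_attain 0; exists x.
- rewrite [X in dual_app f X](_ : _ = t%:num *: x + (1 - t%:num) *: y)//.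
  have t0 : 0 <= t%:num :> R by [].
  have t1 : 0 <= 1 - t%:num :> R by rewrite subr_ge0.
  rewrite dual_addr !dual_scaler.
  have := ler_wpM2l t0 (Wx f); have := ler_wpM2l t1 (Wy f).
  by rewrite !mulrBl; lra.
- exact: dominated_points_weakly_compact.
Qed.

Lemma support_dominated_points (f : V) : support_fun f dominated_points = p f.
Proof.
have [x Wx fx] := dominated_points_attain f; apply/eqP; rewrite eq_le.
apply/andP; split; first by apply: support_fun_le => [|y]; [exists x|exact].
by rewrite -fx support_fun_ub//; exact: dominated_points_weakly_compact.
Qed.

End support_set.

(** * Left continuity in the level and assembly of the fuzzy integral *)

Section fuzzy.
Context d (T : measurableType d) (R : realType) (X : completeNormedModType R).
Variable mu : {measure set T -> \bar R}.
Variables (G : T -> fuzzy_number X).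
Hypothesis G_int : fuzzy_scalarly_integrable mu G.
Local Notation V := (dual X).
Let L (r : R) w := level_set (G w) r.

Lemma level_weakly_compact r w : 0 < r <= 1 -> weakly_compact (L r w).
Proof. by move=> r01; case: (fuzzy_level (G w) r01). Qed.

Lemma level_nonempty r w : 0 < r <= 1 -> L r w !=set0.
Proof. by move=> r01; case: (fuzzy_level (G w) r01). Qed.

Lemma level_mono r s w : r <= s -> L s w `<=` L r w.
Proof. by move=> rs x; exact: le_trans. Qed.

(** For [r > 0] these levels increase to [r] from below; the shift to [n.+2] keeps the first one
    positive. *)
Let below (r : R) (n : nat) : R := r * (1 - n.+2%:R^-1).

Let below_lt r n : 0 < r -> 0 < below r n < r.
Proof.
move=> r0; have h : 0 < (n.+2%:R^-1 : R) < 1.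
  by rewrite invr_gt0 ltr0n invf_lt1// ltr1n.
by move/andP: h => [h1 h2]; rewrite /below mulr_gt0 ?subr_gt0// gtr_pMr// ltrBlDr ltrDl h1.
Qed.

Let below01 r n : 0 < r <= 1 -> 0 < below r n <= 1.
Proof.
move=> /andP[r0 r1]; have /andP[h1 h2] := below_lt n r0.
by rewrite h1 (le_trans (ltW h2)).
Qed.

Let below_mono r n : 0 < r -> below r n <= below r n.+1.
Proof.
move=> r0; rewrite /below ler_pM2l// lerB// lef_pV2 ?posrE ?ltr0n//.
by rewrite ler_nat.
Qed.

Let below_cvg r t : 0 < r -> (forall n, below r n <= t) -> r <= t.
Proof.
move=> r0 h; apply/ler_addgt0Pr => e e0.
have [n _ /(_ n (leqnn n)) hn] := near_infty_natSinv_lt (PosNum (divr_gt0 e0 r0)).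
have := h n; rewrite /below mulrBr mulr1 => hh; rewrite -lerBlDr (le_trans _ hh)//.
rewrite lerD2l lerN2; have := hn; rewrite /= ltr_pdivlMr// mulrC => /ltW; apply: le_trans.
by rewrite ler_pM2l// lef_pV2 ?posrE ?ltr0n// ler_nat.
Qed.

(** An ultralimit of maximizers of [f] on the levels [below r n] lies in all of these levels, hence
    in level [r]; so the support functions cannot stay above that of level [r]. *)
Lemma support_level_cvg r w (f : V) : 0 < r <= 1 ->
  support_fun f (L (below r n) w) @[n --> \oo] --> support_fun f (L r w).
Proof.
move=> r01; have /andP[r0 r1] := r01.
have cB n : weakly_compact (L (below r n) w) by apply: level_weakly_compact; exact: below01.
have B0 n : L (below r n) w !=set0 by apply: level_nonempty; exact: below01.
have BS n : L (below r n.+1) w `<=` L (below r n) w by apply: level_mono; exact: below_mono.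
have Bmono m n : (m <= n)%N -> L (below r n) w `<=` L (below r m) w.
  move=> /subnK <-; elim: (n - m)%N => // k ih.
  by rewrite addSn; exact: subset_trans (BS _) ih.
have sle n : support_fun f (L r w) <= support_fun f (L (below r n) w).
  apply: support_fun_mono => //; first exact: level_nonempty.
  by apply: level_mono; have /andP[_ /ltW] := below_lt n r0.
have lb : has_lbound (range (fun n => support_fun f (L (below r n) w))).
  by exists (support_fun f (L r w)) => _ [n _ <-].
have -> : support_fun f (L r w) = inf (range (fun n => support_fun f (L (below r n) w))).
  apply/eqP; rewrite eq_le; apply/andP; split.
    by apply: lb_le_inf; [exists (support_fun f (L (below r 0%N) w)), 0%N|move=> _ [n _ <-]].
  have /choice[a ha] : forall n, exists x, L (below r n) w x /\
      f x = support_fun f (L (below r n) w).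
    by move=> n; have [x Lx fx] := support_fun_attained f (cB n) (B0 n); exists x.
  have [U [UU oU]] := free_ultrafilter.
  have lim m : exists2 x, L (below r m) w x & forall g : V, g (a i) @[i --> U] --> g x.
    apply: weakly_compact_cvg => //; apply: oU; exists m => // n /= mn.
    exact: Bmono (ha n).1.
  have [x _ xl] := lim 0%N.
  have Lx : L r w x.
    apply: below_cvg => // m; have [y Ly yl] := lim m.
    rewrite (_ : x = y)//; apply: dual_eq_point => g.
    exact: cvg_unique (xl g) (yl g).
  have fx : f x <= support_fun f (L r w).
    by apply: support_fun_ub => //; exact: level_weakly_compact.
  apply: le_trans fx.
  apply: cvg_ge_near (xl f) _; apply: nearW => n; rewrite (ha n).2.
  by apply: ge_inf => //; exists n.
apply: nonincreasing_cvgn => //; apply/nonincreasing_seqP => n.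
exact: support_fun_mono.
Qed.

Lemma support_integral_level_cvg r A (f : V) : measurable A -> 0 < r <= 1 ->
  support_integral mu (L (below r n)) A f @[n --> \oo] -->
    support_integral mu (L r) A f.
Proof.
move=> mA r01; have /andP[r0 r1] := r01.
have iB n : scalarly_integrable mu (L (below r n)) by apply: G_int; exact: below01.
have ir : scalarly_integrable mu (L r) by exact: G_int.
have b01 := below01 0%N r01.
have [|||||_ _ h] := @dominated_convergence _ T R mu A mA
  (fun n w => (support_fun f (L (below r n) w))%:E)
  (fun w => (support_fun f (L r w))%:E)
  (fun w => (support_norm (L (below r 0%N)) f w)%:E).
- by move=> n; apply: measurable_int (support_integrable (iB n) f mA).
- exact: measurable_int (support_integrable ir f mA).
- by apply: aeW => w _; apply: cvg_EFin; [exact: nearW|exact: support_level_cvg].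
- apply: (support_norm_integrable (G := L (below r 0%N))) => // w.
  + exact: level_weakly_compact.
  + exact: level_nonempty.
- apply: aeW => w n _; rewrite /= lee_fin.
  have cB : weakly_compact (L (below r n) w).
    by apply: level_weakly_compact; exact: below01.
  have [x Lx <-] := support_fun_attained f cB (level_nonempty w (below01 n r01)).
  apply: norm_le_support_norm => [w'|]; first exact: level_weakly_compact.
  apply: level_mono Lx.
  by elim: n {cB x} => // n ih; exact: le_trans ih (below_mono n r0).
- apply: fine_cvg; rewrite /support_integral Rintegral_fin//.
  exact: support_integrable.
Qed.

Hypothesis no_c0 : ~ contains_copy (c0 R) X.
Variable K : set X.
Hypothesis cK : weakly_compact K.
Hypothesis KG : forall (r : R) (f : V), 0 < r <= 1 ->
  (forall x, K x -> f x = 0) -> {ae mu, forall w, support_fun f (L r w) = 0}.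

Section level_sets.
Variable A : set T.
Hypothesis mA : measurable A.

Let sublinear_level r : 0 < r <= 1 -> sublinear (support_integral mu (L r) A).
Proof.
move=> r01; apply: support_integral_sublinear => // [w|w|].
- exact: level_weakly_compact.
- exact: level_nonempty.
- exact: G_int.
Qed.

Let level_eval r (l : V -> R) : 0 < r <= 1 -> scalar l ->
  (forall f, l f <= support_integral mu (L r) A f) ->
  exists x, forall f, l f = f x.
Proof.
move=> r01 sl lA.
have [|||f|x _ xl] := @dominated_represented _ T R X mu (L r) _ _ _ A K mA cK _ no_c0 l sl lA.
- by move=> w; exact: level_weakly_compact.
- by move=> w; exact: level_nonempty.
- exact: G_int.
- exact: KG.
- by exists x.
Qed.

Definition integral_level r := dominated_points (support_integral mu (L r) A).

Lemma integral_level_cwk r : 0 < r <= 1 -> cwk (integral_level r).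
Proof.
move=> r01; apply: dominated_points_cwk; first exact: sublinear_level.
by move=> l; exact: level_eval.
Qed.

Lemma support_integral_level r (f : V) : 0 < r <= 1 ->
  (support_fun f (integral_level r))%:E =
  (\int[mu]_(w in A) (support_fun f (L r w))%:E)%E.
Proof.
move=> r01; rewrite support_dominated_points; [|exact: sublinear_level|].
  by rewrite Rintegral_fin//; apply: support_integrable => //; exact: G_int.
by move=> l; exact: level_eval.
Qed.

Lemma integral_level_mono r s : 0 < r <= 1 -> 0 < s <= 1 -> r <= s ->
  integral_level s `<=` integral_level r.
Proof.
move=> r01 s01 rs x Wx f; apply: le_trans (Wx f) _; apply: le_Rintegral => //.
- by apply: support_integrable => //; exact: G_int.
- by apply: support_integrable => //; exact: G_int.
- move=> w _; apply: support_fun_mono; [exact: level_weakly_compact|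
    exact: level_nonempty|exact: level_mono].
Qed.

Lemma integral_level_left_continuous r x : 0 < r <= 1 ->
  (forall s, 0 < s < r -> integral_level s x) -> integral_level r x.
Proof.
move=> r01 h f; have /andP[r0 r1] := r01.
have hc : support_integral mu (L (below r n)) A f @[n --> \oo] -->
    support_integral mu (L r) A f by exact: support_integral_level_cvg.
apply: (@cvg_ge_near _ _ \oo _ _ _ _ hc).
by apply: nearW => n; apply: (h (below r n)); exact: below_lt.
Qed.

(** Including [0] keeps the set nonempty, so that a point in no level gets grade [0]. *)
Let grades x : set R := [set t | t = 0 \/ 0 < t <= 1 /\ integral_level t x].

Let grades_has_sup x : has_sup (grades x).
Proof.
split; first by exists 0; left.
by exists 1 => t [->//|[/andP[_ t1] _]].
Qed.

Definition integral_membership x : R := sup (grades x).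

Lemma integral_membership_range x : 0 <= integral_membership x <= 1.
Proof.
apply/andP; split; first by apply: sup_upper_bound => //; left.
apply: ge_sup; first by exists 0; left.
by move=> t [->//|[/andP[_ t1] _]].
Qed.

(** The supremum is not known in advance to be attained: a grade of at least [r] gives membership in
    the levels below [r], and left continuity passes to [r]. *)
Lemma level_integral_membership r : 0 < r <= 1 ->
  level_set integral_membership r = integral_level r.
Proof.
move=> r01; have /andP[r0 r1] := r01.
apply/seteqP; split=> x; last first.
  by move=> Wx; apply: sup_upper_bound => //; right.
move=> rx; apply: integral_level_left_continuous => // s /andP[s0 sr].
have [t [->|[t01 Wt]] st] := sup_gt (grades_has_sup x).1 (lt_le_trans sr rx).
  by have := lt_trans s0 st; rewrite ltxx.
apply: integral_level_mono Wt => //; last exact: ltW.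
by rewrite s0 (le_trans (ltW sr)).
Qed.

(** Kept transparent because [level_fuzzy_integral] identifies its membership function by
    conversion. *)
Definition fuzzy_integral : fuzzy_number X.
Proof.
apply: (@FuzzyNumber R X integral_membership integral_membership_range) => r r01.
by rewrite level_integral_membership//; exact: integral_level_cwk.
Defined.

Lemma level_fuzzy_integral r : 0 < r <= 1 ->
  level_set fuzzy_integral r = integral_level r.
Proof. exact: level_integral_membership. Qed.

End level_sets.

Lemma fuzzy_pettis : fuzzy_pettis_integrable mu G.
Proof.
split=> [r r01|A mA].
  split=> [|A mA]; first exact: G_int.
  exists (integral_level A r); split=> [|f]; first exact: integral_level_cwk.
  exact: (support_integral_level mA (Dual f)).
exists (fuzzy_integral mA) => r f r01; rewrite level_fuzzy_integral//.
exact: (support_integral_level mA (Dual f)).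
Qed.

End fuzzy.

Theorem theorem3p13 (d : measure_display) (T : measurableType d) (R : realType)
    (mu : {measure set T -> \bar R}) (X : completeNormedModType R)
    (no_c0 : ~ contains_copy (c0 R) X)
    (G : T -> fuzzy_number X) (G_int : fuzzy_scalarly_integrable mu G)
    (Y : set X) (Y_WCG : WCG Y) (Y_G : determines mu Y G) :
  fuzzy_pettis_integrable mu G.
Proof.
have [_ [K [cK _ YK]]] := Y_WCG.
apply: (fuzzy_pettis G_int no_c0 cK) => r f r01 fK; apply: Y_G => // y.
by rewrite YK => /(closure_span_eq0 fK).
Qed.
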